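(* Let $F=\{F_i\}_{i=1,\dots,l}$ be an abelian (pairwise commuting) family of germs of holomorphic diffeomorphisms of $(\mathbb C^n,0)$, $F_i(x)=D_ix+f_i(x)$ with $f_i(0)=0$, $Df_i(0)=0$ and $D_i=\mathrm{diag}(\mu_{i,1},\dots,\mu_{i,n})$ invertible. Assume that the family $D=\{D_ix\}_{i=1,\dots,l}$ is diophantine. If $F$ is formally linearizable, then $F$ is holomorphically linearizable in $(\mathbb C^n,0)$.
   Context: For $Q\in\mathbb N^n$: $|Q|=q_1+\dots+q_n$, $\mu_i^Q=\mu_{i,1}^{q_1}\cdots\mu_{i,n}^{q_n}$. For $k\ge1$ let $$\omega_k(D)=\inf\{\max_{1\le i\le l}|\mu_i^Q-\mu_{i,j}|\ne0\mid 2\le|Q|\le2^k,\ 1\le j\le n,\ Q\in\mathbb N^n\}.$$ The family $D$ is diophantine if $-\sum_{k\ge1}\frac{\ln\omega_k(D)}{2^k}<+\infty$. $F$ is formally (resp. holomorphically) linearizable if there is a single formal diffeomorphism (resp. germ of holomorphic diffeomorphism) $\Phi$ of $(\mathbb C^n,0)$, tangent to the identity at $0$, such that $\Phi\circ F_i\circ\Phi^{-1}(x)=D_ix$ for all $1\le i\le l$. *)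

(* Defs.v *)
From HB Require Import structures.
From mathcomp Require Import all_boot all_order all_algebra.
(* mpoly has to be imported before MathComp-Analysis: in the other order their
   notations clash. *)
From mathcomp Require Import mpoly.
From mathcomp Require Import all_classical all_reals all_analysis.
From mathcomp Require Import complex.

Set Implicit Arguments.
Unset Strict Implicit.
Unset Printing Implicit Defensive.

Import Order.TTheory GRing.Theory Num.Theory.
Import numFieldNormedType.Exports.

Local Open Scope classical_set_scope.
Local Open Scope ring_scope.

(* R[i] gets the topology and norm that every numFieldType carries; this also
   makes 'rV[R[i]]_n a normed space over R[i] (with the sup norm). *)
#[warnings="-redundant-canonical-projection"]
HB.instance Definition _ (R : realType) :=
  NormedModule.copy R[i] (R[i] : numFieldType)^o.

(* The modulus as an element of R; the norm `|z| takes its values in R[i]. *)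
Definition cmod (R : realType) (z : R[i]) : R := ComplexField.Normc.normc z.

Section Germs.
Variables (R : realType) (n : nat).
Local Notation C := R[i].
Local Notation Cn := 'rV[R[i]]_n.

Definition cmonom (z : 'I_n -> C) (Q : 'X_{1..n}) : C :=
  \prod_(j < n) z j ^+ Q j.

Definition coordinates (x : Cn) : 'I_n -> C := fun j => x 0 j.

(* A formal power series is its family of coefficients. *)
Definition formal_series := 'X_{1..n} -> C.

Definition expands_to (f : Cn -> C) (a : formal_series) : Prop :=
  \forall x \near (0 : Cn),
    summable [set: 'X_{1..n}]
      (fun Q => (cmod (a Q * cmonom (coordinates x) Q))%:E) /\
    (fun d : nat => \sum_(Q : 'X_{1..n < d}) a Q * cmonom (coordinates x) Q) @ \oo
      --> f x.

Definition formal_map := 'I_n -> formal_series.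

Definition taylor_expansion (F : Cn -> Cn) (A : formal_map) : Prop :=
  forall j, expands_to (fun x => F x 0 j) (A j).

(* Functions stand for their germs at 0; a germ is holomorphic when it is given
   by a convergent power series. *)
Definition holo_germ (F : Cn -> Cn) : Prop := exists A, taylor_expansion F A.

Definition germ_eq (F G : Cn -> Cn) : Prop :=
  \forall x \near (0 : Cn), F x = G x.

Definition holo_diffeo_with_inverse (F G : Cn -> Cn) : Prop :=
  [/\ holo_germ F /\ holo_germ G, F 0 = 0 /\ G 0 = 0,
      germ_eq (G \o F) id & germ_eq (F \o G) id].

Definition holo_diffeo (F : Cn -> Cn) : Prop :=
  exists G, holo_diffeo_with_inverse F G.

Definition diag_map (mu : 'I_n -> C) (x : Cn) : Cn :=
  \row_j (mu j * x 0 j).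

Definition series_trunc (d : nat) (a : formal_series) : {mpoly C[n]} :=
  \sum_(Q : 'X_{1..n < d}) a Q *: 'X_[Q].

(* Substitution of B in A, for B without constant terms: then the coefficients
   of degree at most |Q| of A and B determine the coefficient of index Q. *)
Definition formal_comp (A B : formal_map) : formal_map := fun j Q =>
  let d := (mdeg Q).+1 in
  (series_trunc d (A j) \mPo [tuple series_trunc d (B k) | k < n])@_Q.

Definition formal_diag (mu : 'I_n -> C) : formal_map := fun j Q =>
  if Q == U_(j)%MM then mu j else 0.

Definition formal_id : formal_map := formal_diag (fun=> 1).

Definition formal_vanish (A : formal_map) : Prop := forall j, A j 0%MM = 0.

Definition formal_tangent_id (A : formal_map) : Prop :=
  forall j k, A j U_(k)%MM = (j == k)%:R.

Definition formal_diffeo_with_inverse (A B : formal_map) : Prop :=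
  [/\ formal_vanish A, formal_vanish B,
      formal_comp B A = formal_id & formal_comp A B = formal_id].

End Germs.

Section Families.
Variables (R : realType) (n l : nat).
Local Notation C := R[i].
Local Notation Cn := 'rV[R[i]]_n.

(* The series A i is determined by the germ of F i, so that quantifying it
   existentially or universally makes no difference. *)
Definition formally_linearizable (F : 'I_l -> Cn -> Cn)
    (mu : 'I_l -> 'I_n -> C) : Prop :=
  exists A : 'I_l -> formal_map R n, (forall i, taylor_expansion (F i) (A i)) /\
  exists Phi Psi : formal_map R n,
    [/\ formal_diffeo_with_inverse Phi Psi, formal_tangent_id Phi &
        forall i, formal_comp Phi (formal_comp (A i) Psi) = formal_diag (mu i)].

Definition holomorphically_linearizable (F : 'I_l -> Cn -> Cn)
    (mu : 'I_l -> 'I_n -> C) : Prop :=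
  exists Phi Psi : Cn -> Cn,
    [/\ holo_diffeo_with_inverse Phi Psi, is_diff (0 : Cn) Phi id &
        forall i, germ_eq (Phi \o F i \o Psi) (diag_map (mu i))].

Definition small_divisor (mu : 'I_l -> 'I_n -> C) (Q : 'X_{1..n}) (j : 'I_n)
  : R := \big[Num.max/0]_(i < l) cmod (cmonom (mu i) Q - mu i j).

Local Open Scope ereal_scope.

(* The infimum is taken in the extended reals: it is +oo when every small
   divisor of the range vanishes. *)
Definition omega (mu : 'I_l -> 'I_n -> C) (k : nat) : \bar R :=
  ereal_inf [set s | exists (Q : 'X_{1..n}) (j : 'I_n),
    [/\ (2 <= mdeg Q <= 2 ^ k)%N, small_divisor mu Q j != 0%R &
        s = (small_divisor mu Q j)%:E]].

Definition diophantine (mu : 'I_l -> 'I_n -> C) : Prop :=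
  - (\sum_(1 <= k <oo) lne (omega mu k) * ((2 ^+ k)^-1)%:E) < +oo.

End Families.

(* Main.v *)
(* Write [F_i = D_i + f_i] and let [Th = id + O(2^k + 1)] be a formal
   linearization of the family. In the degrees [2^k < |Q| <= 2^(k+1)] the identity
   [F_i o Th = Th o D_i] reads [f_(i,j,Q) = (mu_i^Q - mu_(i,j)) Th_(j,Q)], so the
   nonresonant part [psi] of [Th] in these degrees is bounded by the [f_i] divided
   by [omega_(k+1)]. Conjugating by [id + psi], and correcting [Th] on the right
   by its resonant part, which commutes with every [D_i], gives a new family with
   a formal linearization [id + O(2^(k+1) + 1)], whence nonlinear parts of order
   [2^(k+1) + 1].
   As the orders double, no quadratic estimate is needed: shrinking the polydisc
   by a factor [g] with [g^(2^k)] proportional to [omega_(k+1)] absorbs the small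
   divisors, and the diophantine condition says that the product of these factors
   is positive. Eigenvalues of modulus greater than 1 are harmless because
   [psi_Q mu_i^Q = f_(i,Q) + mu_(i,j) psi_Q] bounds [psi o D_i] on the same
   polydisc as [f_i]. Norms are sums of [|a_Q| r^|Q|] truncated at an arbitrary
   degree, so that the estimates only involve finite sums. *)
Require Import Defs.
From mathcomp Require Import all_boot all_order all_algebra.
From mathcomp Require Import mpoly ssrcomplements.
From mathcomp Require Import all_classical all_reals all_analysis.
From mathcomp Require Import complex ring lra.
Set Implicit Arguments.
Unset Strict Implicit.
Unset Printing Implicit Defensive.
Import Order.TTheory GRing.Theory Num.Theory.
Import numFieldNormedType.Exports.
Local Open Scope classical_set_scope.
Local Open Scope ring_scope.

(** * Formal maps modulo high degrees *)

(** The given formal linearization may diverge: composing it on the right with any formal map that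
    is tangent to the identity and commutes with all [D_i] gives another one. It serves to solve the
    linearized equations; the limit is the composite of the step maps [id + psi] alone, in general a
    different linearization. No bound on the inverse of [id + psi] enters the iteration. The new
    nonlinear part satisfies [f' = D o psi + f o (id + psi) - psi o F'], where the unknown [F'] on
    the right sits inside [psi], of order at least 2, so its bound follows by induction on the
    truncation degree. A step with [m = 2^k] shrinks the radius three times by [g], with
    [g^m <= 1/2]. The first shrinking turns a bound [a] on [f] into [a/2] on [psi], the second
    leaves room for the compositions and gives [2a] for [f'], the third uses that [f'] has order
    above [2m] and gives [a/2]. The compositions need a room proportional to [1 - g], which may tend
    to 0; but Bernoulli's inequality gives [1 - g >= 1/(2m)], so the room shrinks no faster than the
    bound [a/2^k]. *)

Section PolynomialOrder.
Variables (K : comNzRingType) (n : nat).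
Implicit Types (p q : {mpoly K[n]}) (Q : 'X_{1..n}).

Definition poly_order_ge d p := forall Q, (mdeg Q < d)%N -> p@_Q = 0.

Lemma poly_order_ge_le d e p :
  (d <= e)%N -> poly_order_ge e p -> poly_order_ge d p.
Proof. by move=> de pe Q Qd; apply: pe; apply: leq_trans de. Qed.

Lemma poly_order_ge0 d : poly_order_ge d 0.
Proof. by move=> Q _; rewrite mcoeff0. Qed.

Lemma poly_order_geD d p q :
  poly_order_ge d p -> poly_order_ge d q -> poly_order_ge d (p + q).
Proof. by move=> dp dq Q Qd; rewrite mcoeffD dp ?dq ?addr0. Qed.

Lemma poly_order_geZ d c p : poly_order_ge d p -> poly_order_ge d (c *: p).
Proof. by move=> dp Q Qd; rewrite mcoeffZ dp ?mulr0. Qed.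

Lemma poly_order_geM d e p q :
  poly_order_ge d p -> poly_order_ge e q -> poly_order_ge (d + e) (p * q).
Proof.
move=> dp eq Q Qde; rewrite mcoeffM big1 // => -[k1 k2] /= /eqP QE.
have [k1d|dk1] := ltnP (mdeg k1) d; first by rewrite dp ?mul0r.
have QdE : mdeg Q = (mdeg k1 + mdeg k2)%N by rewrite {1}QE mdegD.
rewrite (eq k2) ?mulr0 //; move: Qde; rewrite {1}QdE => Qde.
by rewrite -(ltn_add2l d); apply: leq_ltn_trans Qde; rewrite leq_add2r.
Qed.

Lemma poly_order_ge_sum (I : Type) (r : seq I) d (G : I -> {mpoly K[n]}) :
  (forall i, poly_order_ge d (G i)) -> poly_order_ge d (\sum_(i <- r) G i).
Proof.
move=> dG; elim/big_rec: _ => [|i p _ dp]; first exact: poly_order_ge0.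
exact: poly_order_geD.
Qed.

(** Invariant for two products of [d] factors of order at least 1 whose corresponding factors agree
    below degree [e]: changing one factor costs order [e] and leaves [d - 1] others, hence the
    predecessor. *)
Definition close_products d e p q :=
  [/\ poly_order_ge d p, poly_order_ge d q & poly_order_ge (e + d).-1 (p - q)].

Lemma close_productsM d d' e p p' q q' : close_products d e p q ->
  close_products d' e p' q' -> close_products (d + d') e (p * p') (q * q').
Proof.
move=> [dp dq epq] [dp' dq' epq']; split; [exact: poly_order_geM..|].
rewrite (_ : _ - _ = p * (p' - q') + (p - q) * q'); last first.
  by rewrite mulrBr mulrBl addrA subrK.
apply: poly_order_geD.
  apply: poly_order_ge_le (poly_order_geM dp epq').
  by rewrite addnA (addnC e d) -addnA; case: (e + d')%N => [|k] /=;
     [rewrite addn0 leq_pred|rewrite addnS].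
apply: poly_order_ge_le (poly_order_geM epq dq').
by rewrite addnA; case: (e + d)%N => [|k] /=; rewrite ?add0n ?leq_pred ?addSn.
Qed.

Lemma close_products1 e : close_products 0 e 1 1.
Proof. by split=> // Q; rewrite subrr mcoeff0. Qed.

Variables (e : nat) (q q' : 'I_n -> {mpoly K[n]}).
Hypothesis q_ge1 : forall i, poly_order_ge 1 (q i).
Hypothesis q'_ge1 : forall i, poly_order_ge 1 (q' i).
Hypothesis q_close : forall i, poly_order_ge e (q i - q' i).

Lemma close_monomials Q : close_products (mdeg Q) e
  (\prod_(i < n) q i ^+ Q i) (\prod_(i < n) q' i ^+ Q i).
Proof.
rewrite mdegE; elim/big_ind3: _ => [|? ? ? ? ? ? H H'|i _].
- exact: close_products1.
- exact: close_productsM.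
elim: (Q i) => [|k IHk]; first by rewrite !expr0; exact: close_products1.
rewrite !exprS -add1n; apply: close_productsM => //.
by split=> //; rewrite addn1.
Qed.

Lemma comp_mktupleE p : p \mPo [tuple q i | i < n] =
  \sum_(Q <- msupp p) p@_Q *: \prod_(i < n) q i ^+ Q i.
Proof.
rewrite comp_mpolyE; apply: eq_bigr => Q _; congr (_ *: _).
by apply: eq_bigr => i _; rewrite tnth_mktuple.
Qed.

End PolynomialOrder.

Lemma poly_order_ge_comp (K : comNzRingType) n d (p : {mpoly K[n]})
    (q : 'I_n -> {mpoly K[n]}) : (forall i, poly_order_ge 1 (q i)) ->
  poly_order_ge d p -> poly_order_ge d (p \mPo [tuple q i | i < n]).
Proof.
move=> q1 dp; rewrite comp_mktupleE; apply: poly_order_ge_sum => Q.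
have [Qd|dQ] := ltnP (mdeg Q) d.
  by rewrite dp ?scale0r //; exact: poly_order_ge0.
apply/poly_order_geZ/(poly_order_ge_le dQ).
have qq i : poly_order_ge 0 (q i - q i) by [].
by have [] := close_monomials q1 q1 qq Q.
Qed.

(** A monomial of degree above [s] keeps at least [s] factors of order 1 besides the one that
    changes from [q] to [q']; the constant term of [p] cancels in the difference. The case [s = 0]
    covers every [p]. *)
Lemma poly_order_ge_compB (K : comNzRingType) n s e (p : {mpoly K[n]})
    (q q' : 'I_n -> {mpoly K[n]}) :
  (forall Q, (0 < mdeg Q <= s)%N -> p@_Q = 0) ->
  (forall i, poly_order_ge 1 (q i)) -> (forall i, poly_order_ge 1 (q' i)) ->
  (forall i, poly_order_ge e (q i - q' i)) ->
  poly_order_ge (e + s)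
    ((p \mPo [tuple q i | i < n]) - (p \mPo [tuple q' i | i < n])).
Proof.
move=> ps q1 q1' qq'; rewrite !comp_mktupleE -sumrB.
apply: poly_order_ge_sum => Q; rewrite -scalerBr.
have [Q0|Q0] := posnP (mdeg Q).
  move/eqP: Q0; rewrite mdeg_eq0 => /eqP->.
  rewrite !big1 ?subrr ?scaler0 => [|i _|i _]; first exact: poly_order_ge0.
    by rewrite mnm0E expr0.
  by rewrite mnm0E expr0.
have [Qs|sQ] := leqP (mdeg Q) s.
  by rewrite ps ?Q0 ?scale0r //; exact: poly_order_ge0.
apply: poly_order_geZ; have [_ _] := close_monomials q1 q1' qq' Q.
apply: poly_order_ge_le; case: (mdeg Q) sQ => // k; rewrite ltnS addnS.
by rewrite leq_add2l.
Qed.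

Lemma comp_mpolyA (K : comNzRingType) n (p : {mpoly K[n]})
    (q r : 'I_n -> {mpoly K[n]}) :
  ((p \mPo [tuple q i | i < n]) \mPo [tuple r i | i < n]) =
  (p \mPo [tuple (q i \mPo [tuple r i | i < n]) | i < n]).
Proof.
rewrite (comp_mktupleE q p) [RHS]comp_mktupleE raddf_sum /=.
apply: eq_bigr => Q _; rewrite comp_mpolyZ rmorph_prod; congr (_ *: _).
by apply: eq_bigr => i _; rewrite rmorphXn.
Qed.

(** * Formal maps: congruence modulo a degree, composition, inversion *)

Section FormalMaps.
Variables (R : realType) (n : nat).
Local Notation C := R[i].
Implicit Types (A B G : formal_map R n) (mu : 'I_n -> C).

Definition formal_add A B : formal_map R n := fun j Q => A j Q + B j Q.
Definition formal_sub A B : formal_map R n := fun j Q => A j Q - B j Q.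

Definition agree d A B := forall j Q, (mdeg Q < d)%N -> A j Q = B j Q.

Lemma agree_refl d A : agree d A A.
Proof. by []. Qed.

Lemma agree_sym d A B : agree d A B -> agree d B A.
Proof. by move=> AB j Q Qd; rewrite AB. Qed.

Lemma agree_trans d A B G : agree d A B -> agree d B G -> agree d A G.
Proof. by move=> AB BG j Q Qd; rewrite AB ?BG. Qed.

Lemma agree_le d e A B : (d <= e)%N -> agree e A B -> agree d A B.
Proof. by move=> de AB j Q Qd; apply: AB; apply: leq_trans de. Qed.

Lemma agreeP A B : (forall d, agree d A B) -> A = B.
Proof.
by move=> AB; apply/funext => j; apply/funext => Q; exact: AB (ltnSn _).
Qed.

Lemma agree_vanish d A B : agree d.+1 A B -> formal_vanish B -> formal_vanish A.
Proof. by move=> AB B0 j; rewrite AB ?mdeg0. Qed.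

Lemma formal_diag_vanish mu : formal_vanish (formal_diag mu).
Proof. by move=> j; rewrite /formal_diag eq_sym mnm1_eq0. Qed.

Lemma formal_sub_vanish A B :
  formal_vanish A -> formal_vanish B -> formal_vanish (formal_sub A B).
Proof. by move=> A0 B0 j; rewrite /formal_sub A0 B0 subr0. Qed.

Lemma formal_subK A B : formal_add A (formal_sub B A) = B.
Proof.
by apply/funext => j; apply/funext => Q; rewrite /formal_add addrC subrK.
Qed.

Lemma series_truncE d (a : formal_series R n) Q :
  (series_trunc d a)@_Q = if (mdeg Q < d)%N then a Q else 0.
Proof.
case: ifPn => Qd; first by rewrite mcoeff_mpoly.
rewrite raddf_sum big1 //= => -[P Pd] _ /=; rewrite mcoeffZ mcoeffX.
case: eqP => [PQ|_]; last by rewrite mulr0.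
by move: Qd; rewrite -PQ Pd.
Qed.

Lemma series_truncT d (a : formal_series R n) Q :
  (mdeg Q < d)%N -> (series_trunc d a)@_Q = a Q.
Proof. by rewrite series_truncE => ->. Qed.

Lemma series_trunc_order d A :
  formal_vanish A -> forall k, poly_order_ge 1 (series_trunc d (A k)).
Proof.
move=> A0 k Q; rewrite ltnS leqn0 mdeg_eq0 => /eqP->.
by rewrite series_truncE A0 if_same.
Qed.

(** [formal_comp] truncates at a degree that depends on [Q]. Here any polynomials congruent to the
    two series below a degree above that of [Q] will do, which reduces identities between formal
    maps to identities between polynomials. Arbitrary representatives matter because a composite of
    truncations is no longer a truncation. *)
Lemma formal_comp_poly d A B j Q (p : {mpoly C[n]}) (q : 'I_n -> {mpoly C[n]}) :
  formal_vanish B -> (mdeg Q < d)%N ->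
  (forall P, (mdeg P < d)%N -> p@_P = A j P) ->
  (forall k P, (mdeg P < d)%N -> (q k)@_P = B k P) ->
  formal_comp A B j Q = (p \mPo [tuple q k | k < n])@_Q.
Proof.
move=> B0 Qd pA qB; rewrite /formal_comp; set e := (mdeg Q).+1.
have q1 k : poly_order_ge 1 (q k).
  move=> P; rewrite ltnS leqn0 mdeg_eq0 => /eqP->.
  by rewrite qB ?B0 // mdeg0; apply: leq_ltn_trans Qd.
have q'1 := series_trunc_order e B0.
have eq_e P : (mdeg P < e)%N -> (mdeg P < d)%N.
  by rewrite ltnS => PQ; apply: leq_ltn_trans Qd.
apply/eqP; rewrite -subr_eq0 -mcoeffB; apply/eqP.
set p' := series_trunc _ _.
rewrite -(subrKA (p' \mPo [tuple q k | k < n])) mcoeffD.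
rewrite [X in X + _](@poly_order_ge_compB _ _ 0 e) ?addn0 //; last 2 first.
- by move=> P; case: (mdeg P).
- by move=> k P Pe; rewrite mcoeffB series_truncE Pe qB ?subrr //; exact: eq_e.
rewrite add0r -comp_mpolyB (@poly_order_ge_comp _ _ e) //.
by move=> P Pe; rewrite mcoeffB series_truncE Pe pA ?subrr //; exact: eq_e.
Qed.

Lemma formal_compE d A B j Q : formal_vanish B -> (mdeg Q < d)%N ->
  formal_comp A B j Q =
    (series_trunc d (A j) \mPo [tuple series_trunc d (B k) | k < n])@_Q.
Proof.
by move=> B0 Qd; apply: (formal_comp_poly B0 Qd) => [P|k P]; exact: series_truncT.
Qed.

Lemma formal_comp0E A B j : formal_vanish B -> formal_comp A B j 0%MM = A j 0%MM.
Proof.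
move=> B0; rewrite (@formal_compE 1) ?mdeg0 //.
have -> : series_trunc 1 (A j) = (A j 0%MM)%:MP.
  apply/mpolyP => Q; rewrite series_truncE mcoeffC ltnS leqn0 mdeg_eq0.
  by case: eqP => [->|_]; rewrite ?mulr1 ?mulr0.
by rewrite comp_mpolyC mcoeffC eqxx mulr1.
Qed.

Lemma formal_comp_vanish A B :
  formal_vanish A -> formal_vanish B -> formal_vanish (formal_comp A B).
Proof. by move=> A0 B0 j; rewrite formal_comp0E. Qed.

Lemma formal_compA A B G : formal_vanish B -> formal_vanish G ->
  formal_comp A (formal_comp B G) = formal_comp (formal_comp A B) G.
Proof.
move=> B0 G0; apply/funext => j; apply/funext => Q.
set d := (mdeg Q).+1.
pose p := series_trunc d (A j).
pose q := fun k => series_trunc d (B k); pose r := fun k => series_trunc d (G k).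
have pA := @series_truncT d (A j); have rG k := @series_truncT d (G k).
have qr k P : (mdeg P < d)%N ->
    (q k \mPo [tuple r i | i < n])@_P = formal_comp B G k P.
  by move=> Pd; rewrite (formal_compE _ _ G0 Pd).
have pq P : (mdeg P < d)%N ->
    (p \mPo [tuple q i | i < n])@_P = formal_comp A B j P.
  by move=> Pd; rewrite (formal_compE _ _ B0 Pd).
rewrite (formal_comp_poly (formal_comp_vanish B0 G0) (ltnSn _) pA qr).
by rewrite (formal_comp_poly G0 (ltnSn _) pq rG) comp_mpolyA.
Qed.

Lemma formal_comp1l B : formal_vanish B -> formal_comp (@formal_id R n) B = B.
Proof.
move=> B0; apply/funext => j; apply/funext => Q.
have pX P : (mdeg P < (mdeg Q).+1)%N -> ('X_j)@_P = @formal_id R n j P.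
  by rewrite mcoeffX /formal_id /formal_diag eq_sym; case: eqP.
rewrite (formal_comp_poly B0 (ltnSn _) pX (fun k => @series_truncT _ (B k))).
by rewrite comp_mpolyXU -tnth_nth tnth_mktuple series_truncT.
Qed.

Lemma formal_comp1r A : formal_comp A (@formal_id R n) = A.
Proof.
apply/funext => j; apply/funext => Q.
have pX k P : (mdeg P < (mdeg Q).+1)%N -> ('X_k)@_P = @formal_id R n k P.
  by rewrite mcoeffX /formal_id /formal_diag eq_sym; case: eqP.
rewrite (formal_comp_poly (@formal_diag_vanish _) (ltnSn _)
  (@series_truncT _ (A j)) pX).
by rewrite comp_mpoly_id series_truncT.
Qed.

Lemma coeff_diag mu k P : (mu k *: 'X_k)@_P = formal_diag mu k P.
Proof.
rewrite mcoeffZ mcoeffX /formal_diag eq_sym.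
by case: eqP; rewrite ?mulr1 ?mulr0.
Qed.

Lemma formal_comp_diagl mu B : formal_vanish B ->
  formal_comp (formal_diag mu) B = fun j Q => mu j * B j Q.
Proof.
move=> B0; apply/funext => j; apply/funext => Q.
rewrite (formal_comp_poly B0 (ltnSn _) (fun P _ => coeff_diag mu j P)
  (fun k => @series_truncT _ (B k))).
by rewrite comp_mpolyZ mcoeffZ comp_mpolyXU -tnth_nth tnth_mktuple series_truncT.
Qed.

(** Composition with the diagonal map on the left multiplies by [mu j] instead: the difference of
    the two factors is the divisor [mu^Q - mu_j]. *)
Lemma formal_comp_diagr mu A :
  formal_comp A (formal_diag mu) = fun j Q => A j Q * cmonom mu Q.
Proof.
apply/funext => j; apply/funext => Q.
rewrite (formal_comp_poly (@formal_diag_vanish _) (ltnSn _)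
  (@series_truncT _ (A j)) (fun k P _ => coeff_diag mu k P)).
have monE P : ('X_[P] \mPo [tuple mu k *: 'X_k | k < n]) =
    cmonom mu P *: ('X_[P] : {mpoly C[n]}).
  rewrite comp_mpolyX mpolyXE_id /cmonom -scaler_prod.
  by apply: eq_bigr => k _; rewrite tnth_mktuple exprZn.
rewrite /series_trunc (raddf_sum (comp_mpoly _)) /= raddf_sum /=.
rewrite (bigD1 (Sub Q (ltnSn (mdeg Q)) : 'X_{1..n < (mdeg Q).+1})) //=.
rewrite big1 ?addr0 => [|P PQ]; last first.
  rewrite comp_mpolyZ monE !mcoeffZ mcoeffX; case: eqP => [PE|]; last first.
    by rewrite !mulr0.
  by move: PQ; rewrite -val_eqE /= PE eqxx.
by rewrite comp_mpolyZ monE !mcoeffZ mcoeffX eqxx mulr1.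
Qed.

Lemma formal_compDl A B G : formal_comp (formal_add A B) G =
  formal_add (formal_comp A G) (formal_comp B G).
Proof.
apply/funext => j; apply/funext => Q.
rewrite /formal_comp /formal_add -mcoeffD -comp_mpolyD; congr (_ \mPo _)@__.
by apply/mpolyP => P; rewrite mcoeffD !series_truncE; case: ifP; rewrite ?addr0.
Qed.

Lemma formal_compBl A B G : formal_comp (formal_sub A B) G =
  formal_sub (formal_comp A G) (formal_comp B G).
Proof.
apply/funext => j; apply/funext => Q.
rewrite /formal_comp /formal_sub -mcoeffB -comp_mpolyB; congr (_ \mPo _)@__.
by apply/mpolyP => P; rewrite mcoeffB !series_truncE; case: ifP; rewrite ?subr0.
Qed.

Lemma agree_compl d A A' G : formal_vanish G ->
  agree d A A' -> agree d (formal_comp A G) (formal_comp A' G).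
Proof.
move=> G0 AA' j Q Qd; rewrite !(formal_compE _ _ G0 Qd).
congr (_ \mPo _)@__; apply/mpolyP => P; rewrite !series_truncE.
by case: ifP => // Pd; exact: AA'.
Qed.

(** Source of the doubling of orders: for [A] without terms of degrees 1 to [m], and [G], [G'] equal
    up to degree [m], the composites are equal up to degree [2m]. *)
Lemma agree_compr e s A G G' :
  (forall j Q, (0 < mdeg Q <= s)%N -> A j Q = 0) ->
  formal_vanish G -> formal_vanish G' -> agree e G G' ->
  agree (e + s) (formal_comp A G) (formal_comp A G').
Proof.
move=> As G0 G0' GG' j Q Qd.
rewrite (formal_compE _ _ G0 Qd) (formal_compE _ _ G0' Qd).
apply/eqP; rewrite -subr_eq0 -mcoeffB; apply/eqP; move: Q Qd.
apply: poly_order_ge_compB; [|exact: series_trunc_order..|].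
  by move=> Q Qs; rewrite series_truncE (As _ _ Qs) if_same.
move=> k P Pe; rewrite mcoeffB !series_truncE GG' //.
by case: ifP => _; rewrite subrr.
Qed.

Lemma agree_comp d A A' G G' : agree d A A' -> formal_vanish G ->
  formal_vanish G' -> agree d G G' ->
  agree d (formal_comp A G) (formal_comp A' G').
Proof.
move=> AA' G0 G0' GG'; apply: agree_trans (agree_compl G0 AA') _.
rewrite -[d]addn0; apply: agree_compr => // j Q.
by case: (mdeg Q).
Qed.

(* [formal_inv_iter A t] is the inverse of [A] up to degree [t + 1]. *)
Fixpoint formal_inv_iter A t : formal_map R n :=
  if t is t'.+1 then formal_sub (@formal_id R n)
    (formal_comp (formal_sub A (@formal_id R n)) (formal_inv_iter A t'))
  else @formal_id R n.

Definition formal_inv A : formal_map R n := fun j Q =>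
  formal_inv_iter A (mdeg Q) j Q.

Section Inverse.
Variable A : formal_map R n.
Hypothesis A_id : agree 2 A (@formal_id R n).

Let a_order j Q : (0 < mdeg Q <= 1)%N -> formal_sub A (@formal_id R n) j Q = 0.
Proof. by case/andP=> _ Q1; rewrite /formal_sub A_id ?subrr. Qed.

Let a_vanish : formal_vanish (formal_sub A (@formal_id R n)).
Proof. by move=> j; rewrite /formal_sub A_id ?subrr // mdeg0. Qed.

Let iter_vanish t : formal_vanish (formal_inv_iter A t).
Proof.
elim: t => [|t IHt]; first exact: formal_diag_vanish.
by apply: formal_sub_vanish;
  [exact: formal_diag_vanish|exact: formal_comp_vanish].
Qed.

Let agree_iterS t : agree t.+2 (formal_inv_iter A t.+1) (formal_inv_iter A t).
Proof.
elim: t => [|t IHt].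
  rewrite /= formal_comp1r => j Q Q2.
  by rewrite /formal_sub A_id // subrr subr0.
have iterS u j Q : formal_inv_iter A u.+1 j Q = @formal_id R n j Q -
    formal_comp (formal_sub A (@formal_id R n)) (formal_inv_iter A u) j Q.
  by [].
move=> j Q Qt; rewrite (iterS t.+1) (iterS t).
rewrite (agree_compr a_order (iter_vanish _) (iter_vanish t) IHt) //.
by rewrite addn1.
Qed.

Let agree_iter t u : (t <= u)%N ->
  agree t.+2 (formal_inv_iter A u) (formal_inv_iter A t).
Proof.
elim: u => [|u IHu]; first by rewrite leqn0 => /eqP->.
rewrite leq_eqVlt => /predU1P[->//|tu].
by apply: agree_trans _ (IHu tu); apply: agree_le _ (@agree_iterS u).
Qed.

Let agree_inv t : agree t.+2 (formal_inv A) (formal_inv_iter A t).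
Proof.
move=> j Q Qt; rewrite /formal_inv; have [Qt'|Qt'] := leqP t (mdeg Q).
  exact: agree_iter.
by rewrite -(agree_iter (ltnW Qt')).
Qed.

Lemma formal_inv_id : agree 2 (formal_inv A) (@formal_id R n).
Proof. exact: agree_inv. Qed.

Lemma formal_inv_vanish : formal_vanish (formal_inv A).
Proof. exact: (agree_vanish formal_inv_id (formal_diag_vanish _)). Qed.

Lemma formal_compV : formal_comp A (formal_inv A) = @formal_id R n.
Proof.
rewrite -[A in formal_comp A](formal_subK (@formal_id R n)) formal_compDl.
rewrite formal_comp1l; last exact: formal_inv_vanish.
apply/funext => j; apply/funext => Q; set a := formal_sub _ _.
have aE : agree (mdeg Q).+3 (formal_comp a (formal_inv A))
    (formal_comp a (formal_inv_iter A (mdeg Q))).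
  rewrite -addn1; apply: (agree_compr a_order _ _ (@agree_inv _)) => //.
  exact: formal_inv_vanish.
rewrite /formal_add (agree_inv (t := (mdeg Q).+1)) ?aE //.
- by rewrite /= /formal_sub subrK.
- by rewrite !ltnS leqW.
- by rewrite !ltnS leqW.
Qed.

End Inverse.

Lemma formal_inv_unique A B : agree 2 A (@formal_id R n) -> formal_vanish B ->
  formal_comp B A = @formal_id R n -> B = formal_inv A.
Proof.
move=> A_id B0 BA; have A0 := agree_vanish A_id (formal_diag_vanish _).
rewrite -[LHS]formal_comp1r -(formal_compV A_id) formal_compA //.
  by rewrite BA formal_comp1l //; exact: formal_inv_vanish.
exact: formal_inv_vanish.
Qed.

(** The right inverse [V] of [A] has a right inverse of its own, and this must be [A], which is a
    left inverse of [V]; hence [V o A = id]. *)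
Lemma formal_mulV A : agree 2 A (@formal_id R n) ->
  formal_comp (formal_inv A) A = @formal_id R n.
Proof.
move=> A_id; have A'_id := formal_inv_id A_id.
have A0 := agree_vanish A_id (formal_diag_vanish _).
rewrite {2}(formal_inv_unique A'_id A0 (formal_compV A_id)).
exact: formal_compV.
Qed.

End FormalMaps.

(** * Weighted norms *)

Section Modulus.
Variable R : realType.
Implicit Types z w : R[i].

Lemma cmod_ge0 z : 0 <= cmod z.
Proof. by case: z => a b; exact: sqrtr_ge0. Qed.

Lemma cmod0 : cmod 0 = 0 :> R.
Proof. exact: ComplexField.Normc.normc0. Qed.

Lemma cmod1 : cmod 1 = 1 :> R.
Proof. exact: ComplexField.Normc.normc1. Qed.

Lemma cmodM z w : cmod (z * w) = cmod z * cmod w.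
Proof. exact: ComplexField.Normc.normcM. Qed.

Lemma cmodN z : cmod (- z) = cmod z.
Proof. exact: normcN. Qed.

Lemma ler_cmodD z w : cmod (z + w) <= cmod z + cmod w.
Proof. exact: le_normcD. Qed.

Lemma ler_cmodB z w : cmod (z - w) <= cmod z + cmod w.
Proof. by rewrite -(cmodN w); exact: ler_cmodD. Qed.

Lemma cmod_eq0 z : (cmod z == 0) = (z == 0).
Proof.
apply/eqP/eqP => [/ComplexField.Normc.eq0_normc//|->]; exact: cmod0.
Qed.

Lemma cmodX z k : cmod (z ^+ k) = cmod z ^+ k.
Proof. by elim: k => [|k IHk]; rewrite ?expr0 ?cmod1 // !exprS cmodM IHk. Qed.

Lemma cmod_prod (I : Type) (r : seq I) (P : pred I) (G : I -> R[i]) :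
  cmod (\prod_(i <- r | P i) G i) = \prod_(i <- r | P i) cmod (G i).
Proof. exact: (big_morph _ cmodM cmod1). Qed.

Lemma ler_cmod_sum (I : Type) (r : seq I) (P : pred I) (G : I -> R[i]) :
  cmod (\sum_(i <- r | P i) G i) <= \sum_(i <- r | P i) cmod (G i).
Proof.
elim/big_rec2: _ => [|i x y _ xy]; first by rewrite cmod0.
by apply: le_trans (ler_cmodD _ _) _; rewrite lerD2l.
Qed.

End Modulus.

Section WeightedNorms.
Variables (R : realType) (n : nat).
Local Notation C := R[i].
Implicit Types (rho sigma : 'I_n -> R) (p q : {mpoly C[n]}).
Implicit Types (a b : formal_series R n) (A B : formal_map R n).

(** The radii depend on the coordinate because [D_i] sends the polydisc of radius [r] to one with
    radii [|mu_(i,k)| r]. *)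
Definition weight rho (Q : 'X_{1..n}) : R := \prod_(j < n) rho j ^+ Q j.

Lemma weight_ge0 rho Q : (forall j, 0 <= rho j) -> 0 <= weight rho Q.
Proof. by move=> rho0; apply: prodr_ge0 => j _; exact: exprn_ge0. Qed.

Lemma weightD rho P Q : weight rho (P + Q)%MM = weight rho P * weight rho Q.
Proof.
by rewrite /weight -big_split /=; apply: eq_bigr => j _; rewrite mnmDE exprD.
Qed.

Lemma weightM rho sigma Q :
  weight (fun j => rho j * sigma j) Q = weight rho Q * weight sigma Q.
Proof.
by rewrite /weight -big_split /=; apply: eq_bigr => j _; rewrite exprMn.
Qed.

Lemma weight_cst (r : R) Q : weight (fun=> r) Q = r ^+ mdeg Q.
Proof. by rewrite /weight mdegE prodrXr. Qed.

Lemma ler_weight rho sigma Q : (forall j, 0 <= rho j <= sigma j) ->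
  weight rho Q <= weight sigma Q.
Proof.
move=> rs; apply: ler_prod => j _; have /andP[r0 rsj] := rs j.
by rewrite exprn_ge0 //= lerXn2r // nnegrE // (le_trans r0).
Qed.

Lemma cmod_cmonom (z : 'I_n -> C) Q :
  cmod (cmonom z Q) = weight (fun j => cmod (z j)) Q.
Proof. by rewrite cmod_prod; apply: eq_bigr => j _; rewrite cmodX. Qed.

Definition poly_norm rho p := \sum_(Q <- msupp p) cmod p@_Q * weight rho Q.

Definition trunc_norm rho d a :=
  \sum_(Q : 'X_{1..n < d}) cmod (a Q) * weight rho Q.

Lemma poly_normE d rho p : (msize p <= d)%N ->
  poly_norm rho p = trunc_norm rho d (fun Q => p@_Q).
Proof.
move=> pd; rewrite /poly_norm (big_mksub 'X_{1..n < d}) /=.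
- rewrite big_rmcond //= => Q; move/memN_msupp_eq0 => ->.
  by rewrite cmod0 mul0r.
- exact: msupp_uniq.
- by move=> Q /msize_mdeg_lt /leq_trans; apply.
Qed.

Section Norms.
Variable rho : 'I_n -> R.
Hypothesis rho0 : forall j, 0 <= rho j.

Let w_ge0 Q : 0 <= weight rho Q.
Proof. exact: weight_ge0. Qed.

Lemma poly_norm_ge0 p : 0 <= poly_norm rho p.
Proof. by apply: sumr_ge0 => Q _; rewrite mulr_ge0 ?cmod_ge0. Qed.

Lemma trunc_norm_ge0 d a : 0 <= trunc_norm rho d a.
Proof. by apply: sumr_ge0 => Q _; rewrite mulr_ge0 ?cmod_ge0. Qed.

Lemma trunc_normD d a b : trunc_norm rho d (fun Q => a Q + b Q) <=
  trunc_norm rho d a + trunc_norm rho d b.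
Proof.
rewrite -big_split /=; apply: ler_sum => Q _.
by rewrite -mulrDl ler_wpM2r // ler_cmodD.
Qed.

Lemma trunc_normB d a b : trunc_norm rho d (fun Q => a Q - b Q) <=
  trunc_norm rho d a + trunc_norm rho d b.
Proof.
rewrite -big_split /=; apply: ler_sum => Q _.
by rewrite -mulrDl ler_wpM2r // ler_cmodB.
Qed.

Lemma trunc_normZ d c a :
  trunc_norm rho d (fun Q => c * a Q) = cmod c * trunc_norm rho d a.
Proof. by rewrite mulr_sumr; apply: eq_bigr => Q _; rewrite cmodM mulrA. Qed.

Lemma poly_norm0 : poly_norm rho 0 = 0.
Proof. by rewrite /poly_norm -mpolyC0 msupp0 big_nil. Qed.

Lemma poly_normD p q : poly_norm rho (p + q) <= poly_norm rho p + poly_norm rho q.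
Proof.
set d := maxn (msize p) (msize q).
rewrite !(poly_normE (d := d)) ?leq_maxl ?leq_maxr ?msizeD_le //.
apply: le_trans (trunc_normD _ _ _); rewrite le_eqVlt; apply/orP; left.
by apply/eqP/eq_bigr => Q _; rewrite mcoeffD.
Qed.

Lemma poly_norm_sum (I : Type) (r : seq I) (G : I -> {mpoly C[n]}) :
  poly_norm rho (\sum_(i <- r) G i) <= \sum_(i <- r) poly_norm rho (G i).
Proof.
elim/big_rec2: _ => [|i x p _ px]; first by rewrite poly_norm0.
by apply: le_trans (poly_normD _ _) _; rewrite lerD2l.
Qed.

Lemma poly_normZ c p : poly_norm rho (c *: p) <= cmod c * poly_norm rho p.
Proof.
rewrite !(poly_normE (d := msize p)) ?msizeZ_le // -trunc_normZ.
rewrite le_eqVlt; apply/orP; left.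
by apply/eqP/eq_bigr => Q _; rewrite mcoeffZ.
Qed.

Lemma poly_normX Q : poly_norm rho 'X_[Q] = weight rho Q.
Proof. by rewrite /poly_norm msuppX big_seq1 mcoeffX eqxx cmod1 mul1r. Qed.

Lemma poly_normM p q : poly_norm rho (p * q) <= poly_norm rho p * poly_norm rho q.
Proof.
rewrite {1}[p]mpolyE mulr_suml; apply: le_trans (poly_norm_sum _ _) _.
rewrite mulr_suml; apply: ler_sum => P _.
rewrite {1}[q]mpolyE mulr_sumr; apply: le_trans (poly_norm_sum _ _) _.
rewrite mulr_sumr; apply: ler_sum => Q _.
rewrite -scalerAl -scalerAr scalerA -mpolyXD.
apply: le_trans (poly_normZ _ _) _.
by rewrite poly_normX weightD cmodM mulrACA.
Qed.

Lemma poly_norm1 : poly_norm rho 1 = 1.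
Proof.
rewrite -mpolyX0 poly_normX /weight big1 // => j _.
by rewrite mnm0E expr0.
Qed.

(** Majorant principle: by subadditivity and submultiplicativity, the norm bounds on [q] act as an
    inclusion of the image of the polydisc [rho] in the polydisc [sigma]. *)
Lemma poly_norm_comp sigma p (q : 'I_n -> {mpoly C[n]}) :
  (forall k, poly_norm rho (q k) <= sigma k) ->
  poly_norm rho (p \mPo [tuple q k | k < n]) <= poly_norm sigma p.
Proof.
move=> qs; rewrite comp_mktupleE; apply: le_trans (poly_norm_sum _ _) _.
apply: ler_sum => Q _; apply: le_trans (poly_normZ _ _) _.
rewrite ler_wpM2l ?cmod_ge0 //.
apply: (big_rec2 (fun x r => poly_norm rho x <= r)); first by rewrite poly_norm1.
move=> k x r _ rx; apply: le_trans (poly_normM _ _) _.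
apply: ler_pM; rewrite ?poly_norm_ge0 //.
elim: (Q k) => [|e IHe]; first by rewrite !expr0 poly_norm1.
rewrite !exprS; apply: le_trans (poly_normM _ _) _.
by apply: ler_pM; rewrite ?poly_norm_ge0.
Qed.

Lemma trunc_norm_le_poly d a p : (forall Q, (mdeg Q < d)%N -> a Q = p@_Q) ->
  trunc_norm rho d a <= poly_norm rho p.
Proof.
move=> ap; rewrite /poly_norm /trunc_norm.
rewrite [leLHS](eq_bigr
  (fun Q : 'X_{1..n < d} => cmod p@_Q * weight rho Q)); last first.
  by move=> Q _; rewrite ap ?bmdeg.
rewrite (bigID (fun Q : 'X_{1..n < d} => val Q \in msupp p)) /=.
rewrite [X in _ + X]big1 ?addr0; last first.
  by move=> Q /memN_msupp_eq0 ->; rewrite cmod0 mul0r.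
rewrite [leRHS](bigID (fun Q : 'X_{1..n} => (mdeg Q < d)%N)) /=.
rewrite (big_mksub_cond 'X_{1..n < d}) /= ?msupp_uniq //.
rewrite [X in _ <= X + _](eq_bigl (fun Q : 'X_{1..n < d} => val Q \in msupp p)).
  by rewrite lerDl sumr_ge0 // => Q _; rewrite mulr_ge0 ?cmod_ge0.
by move=> Q; rewrite bmdeg.
Qed.

Lemma poly_norm_trunc d a : poly_norm rho (series_trunc d a) = trunc_norm rho d a.
Proof.
rewrite (poly_normE (d := d)); last first.
  apply: leq_trans (msize_sum _ _ _) _; apply/bigmax_leqP => Q _.
  by apply: leq_trans (msizeZ_le _ _) _; rewrite msizeX bmdeg.
by apply: eq_bigr => Q _; rewrite series_truncT ?bmdeg.
Qed.

End Norms.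
End WeightedNorms.

#[local] Opaque formal_comp.

Section TruncNormTheory.
Variables (R : realType) (n : nat).
Local Notation C := R[i].
Implicit Types (rho sigma : 'I_n -> R).
Implicit Types (a b : formal_series R n) (A B : formal_map R n).

Lemma weight_mnm1 rho j : weight rho U_(j)%MM = rho j.
Proof.
rewrite /weight (bigD1 j) //= mnm1E eqxx expr1 big1 ?mulr1 // => k kj.
by rewrite mnm1E eq_sym (negbTE kj) expr0.
Qed.

Lemma trunc_norm_deg0 rho a : trunc_norm rho 0 a = 0.
Proof. by rewrite /trunc_norm big_pred0 // => Q; have := bmdeg Q. Qed.

Lemma eq_trunc_norm rho d a b : (forall Q, (mdeg Q < d)%N -> a Q = b Q) ->
  trunc_norm rho d a = trunc_norm rho d b.
Proof. by move=> ab; apply: eq_bigr => Q _; rewrite ab ?bmdeg. Qed.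

Lemma ler_trunc_norm rho sigma d a : (forall j, 0 <= rho j <= sigma j) ->
  trunc_norm rho d a <= trunc_norm sigma d a.
Proof.
move=> rs; apply: ler_sum => Q _; rewrite ler_wpM2l ?cmod_ge0 //.
exact: ler_weight.
Qed.

(** Schwarz lemma for these norms: every monomial present has degree at least [m] and gains a factor
    [g^m]. This gain is what absorbs the small divisors. *)
Lemma trunc_norm_shrink rho (g : R) m d a : (forall j, 0 <= rho j) ->
  0 <= g <= 1 -> (forall Q, (mdeg Q < m)%N -> a Q = 0) ->
  trunc_norm (fun j => g * rho j) d a <= g ^+ m * trunc_norm rho d a.
Proof.
move=> rho0 /andP[g0 g1] am; rewrite mulr_sumr; apply: ler_sum => Q _.
rewrite weightM weight_cst mulrCA; have [Qm|mQ] := ltnP (mdeg Q) m.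
  by rewrite am // cmod0 !mul0r !mulr0.
apply: ler_wpM2r; first by rewrite mulr_ge0 ?cmod_ge0 ?weight_ge0.
by rewrite ler_wiXn2l.
Qed.

Lemma trunc_norm_diag rho mu d j : (forall j, 0 <= rho j) ->
  trunc_norm rho d (formal_diag mu j) <= cmod (mu j) * rho j.
Proof.
move=> rho0; rewrite -[in leRHS](weight_mnm1 rho j) -poly_normX //.
apply: le_trans (poly_normZ _ _ _) => //; apply: trunc_norm_le_poly => // Q _.
by rewrite coeff_diag.
Qed.

Lemma trunc_norm_comp rho sigma d A B j : (forall k, 0 <= rho k) ->
  formal_vanish B -> (forall k, trunc_norm rho d (B k) <= sigma k) ->
  trunc_norm rho d (formal_comp A B j) <= trunc_norm sigma d (A j).
Proof.
move=> rho0 B0 Bs; rewrite -(poly_norm_trunc sigma d (A j)).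
apply: le_trans (poly_norm_comp rho0 (sigma := sigma)
  (q := fun k => series_trunc d (B k)) _ _); last first.
  by move=> k; rewrite poly_norm_trunc.
by apply: (trunc_norm_le_poly rho0) => Q Qd; exact: (formal_compE _ _ B0 Qd).
Qed.

(* If [A] starts at order 2, then the coefficients of degree [d] of [A o B]
   involve those of [B] of degree less than [d] only; this is what makes
   implicit equations [B = ... - A o B] tractable by induction on the degree. *)
Lemma trunc_norm_compS rho sigma d A B j : (forall k, 0 <= rho k) ->
  (forall i Q, (mdeg Q <= 1)%N -> A i Q = 0) ->
  formal_vanish B -> (forall k, trunc_norm rho d (B k) <= sigma k) ->
  trunc_norm rho d.+1 (formal_comp A B j) <= trunc_norm sigma d.+1 (A j).
Proof.
move=> rho0 A2 B0 Bs.
pose B' : formal_map R n := fun k Q => if (mdeg Q < d)%N then B k Q else 0.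
have B'0 : formal_vanish B' by move=> k; rewrite /B' B0 if_same.
have BB' : agree d B B' by move=> k Q Qd; rewrite /B' Qd.
have A1 i Q : (0 < mdeg Q <= 1)%N -> A i Q = 0 by case/andP=> _; exact: A2.
have AB' : agree d.+1 (formal_comp A B) (formal_comp A B').
  by rewrite -addn1; exact: (agree_compr A1 B0 B'0 BB').
rewrite (eq_trunc_norm rho (AB' j)).
apply: trunc_norm_comp => // k; apply: le_trans (Bs k).
rewrite -(poly_norm_trunc rho d); apply: trunc_norm_le_poly => // Q _.
by rewrite series_truncE.
Qed.

End TruncNormTheory.

Lemma cmonom_mnm1 (R : realType) n (z : 'I_n -> R[i]) j : cmonom z U_(j)%MM = z j.
Proof.
rewrite /cmonom (bigD1 j) //= mnm1E eqxx expr1 big1 ?mulr1 // => k kj.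
by rewrite mnm1E eq_sym (negbTE kj) expr0.
Qed.

(** * The normalization steps *)

(* Abstracting from [formal_comp] keeps unification from unfolding it. *)
Section Conjugation.
Variables (M : Type) (comp : M -> M -> M) (ok : M -> Prop) (id : M).
Hypothesis compA : forall A B G, ok B -> ok G ->
  comp A (comp B G) = comp (comp A B) G.
Hypothesis comp1l : forall A, ok A -> comp id A = A.
Hypothesis ok_comp : forall A B, ok A -> ok B -> ok (comp A B).

Lemma comp_invK P V A : ok V -> ok A -> comp P V = id -> comp P (comp V A) = A.
Proof. by move=> V0 A0 PV; rewrite compA // PV comp1l. Qed.

Lemma comp_conj V P G T C D : ok V -> ok P -> ok G -> ok T -> ok C -> ok D ->
  comp P V = id -> comp G T = comp T D -> comp D C = comp C D ->
  comp (comp V (comp G P)) (comp V (comp T C)) = comp (comp V (comp T C)) D.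
Proof.
move=> V0 P0 G0 T0 C0 D0 PV GT DC.
have TC0 := ok_comp T0 C0; have GP0 := ok_comp G0 P0; have VTC0 := ok_comp V0 TC0.
rewrite -(compA V GP0 VTC0) -(compA G P0 VTC0) (comp_invK V0 TC0 PV).
rewrite (compA G T0 C0) GT -(compA T D0 C0) DC (compA T C0 D0).
by rewrite (compA V TC0 D0).
Qed.

Lemma comp_conj_trans A N F P F' : ok N -> ok F -> ok P -> ok F' ->
  comp A N = comp N F -> comp P F' = comp F P ->
  comp A (comp N P) = comp (comp N P) F'.
Proof.
move=> N0 F0 P0 F'0 AN PF; rewrite (compA A N0 P0) AN -(compA N F0 P0) -PF.
exact: compA.
Qed.

End Conjugation.

Section NormalizationStep.
Variables (R : realType) (n l : nat) (mu : 'I_l -> 'I_n -> R[i]).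
Local Notation C := R[i].

Lemma ler_small_divisor Q i j :
  cmod (cmonom (mu i) Q - mu i j) <= small_divisor mu Q j.
Proof. exact: le_bigmax. Qed.

Lemma small_divisor_ge0 Q j : 0 <= small_divisor mu Q j.
Proof.
by rewrite /small_divisor; elim/big_ind: _ => // [x y x0 y0|i _];
  [rewrite le_max x0|exact: cmod_ge0].
Qed.

Lemma small_divisor_eq0 Q i j :
  small_divisor mu Q j = 0 -> cmonom (mu i) Q = mu i j.
Proof.
move=> sd0; apply/eqP; rewrite -subr_eq0 -cmod_eq0 eq_le cmod_ge0 andbT -sd0.
exact: ler_small_divisor.
Qed.

(** The sum over the family avoids selecting, for each coefficient, an index where the maximum is
    attained; the price is a factor [l] in the bounds on [psi]. *)
Lemma small_divisor_le_sum Q j :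
  small_divisor mu Q j <= \sum_(i < l) cmod (cmonom (mu i) Q - mu i j).
Proof.
apply: bigmax_le => [|i _]; first by apply: sumr_ge0 => i _; exact: cmod_ge0.
by rewrite (bigD1 i) //= lerDl; apply: sumr_ge0 => k _; exact: cmod_ge0.
Qed.

Variables (m : nat) (Th : formal_map R n) (F : 'I_l -> formal_map R n).

Definition nonresonant_part : formal_map R n := fun j Q =>
  if (m < mdeg Q <= m.*2)%N && (small_divisor mu Q j != 0) then Th j Q else 0.

Definition resonant_part : formal_map R n := fun j Q =>
  if (m < mdeg Q <= m.*2)%N && (small_divisor mu Q j == 0) then Th j Q else 0.

Definition step_map := formal_add (@formal_id R n) nonresonant_part.

Definition step_linearization := formal_comp (formal_inv step_map)
  (formal_comp Th (formal_sub (@formal_id R n) resonant_part)).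

Definition step_family i :=
  formal_comp (formal_inv step_map) (formal_comp (F i) step_map).

Local Notation D := (fun i => formal_diag (mu i)).
Local Notation f := (fun i => formal_sub (F i) (formal_diag (mu i))).
Local Notation psi := nonresonant_part.
Local Notation Psi := step_map.
Local Notation Th' := step_linearization.
Local Notation F' := step_family.
Local Notation id := (@formal_id R n).
Local Notation Cr := (formal_sub (@formal_id R n) resonant_part).

Hypothesis m_gt0 : (0 < m)%N.
Hypothesis Th_id : agree m.+1 Th id.
Hypothesis F_vanish : forall i, formal_vanish (F i).
Hypothesis F_lin : forall i, formal_comp (F i) Th = formal_comp Th (D i).

Lemma formal_id_vanish : formal_vanish id.
Proof. exact: formal_diag_vanish. Qed.

Let Th_vanish : formal_vanish Th.
Proof. exact: agree_vanish Th_id formal_id_vanish. Qed.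

(** The order of the nonlinear parts is read from the linearization: in [F o Th = Th o D], replacing
    [Th] by the identity changes neither side up to degree [m]. *)
Lemma family_diag i : agree m.+1 (F i) (D i).
Proof.
apply: (@agree_trans _ _ _ _ (formal_comp (F i) Th)).
  rewrite -[X in agree _ X](formal_comp1r (F i)).
  by apply: agree_comp => //; [exact: formal_id_vanish|exact: agree_sym].
rewrite F_lin -[X in agree _ _ X](formal_comp1l (@formal_diag_vanish R n (mu i))).
exact: agree_compl (@formal_diag_vanish _ _ _) Th_id.
Qed.

Lemma dev_order i j Q : (mdeg Q <= m)%N -> f i j Q = 0.
Proof. by move=> Qm; rewrite /formal_sub family_diag ?subrr. Qed.

Lemma formal_diag_high (nu : 'I_n -> C) j Q :
  (1 < mdeg Q)%N -> formal_diag nu j Q = 0.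
Proof. by rewrite /formal_diag; case: eqP => // ->; rewrite mdeg1. Qed.

(** Both [f] and [Th - id] start above degree [m], so [f o Th] and [f] coincide up to degree [2m];
    and [f o Th = Th o D - D o Th] has the stated coefficients. *)
Lemma cohomological_equation i j Q : (m < mdeg Q <= m.*2)%N ->
  f i j Q = (cmonom (mu i) Q - mu i j) * Th j Q.
Proof.
case/andP=> mQ Qm.
have f_Th : agree (m.+1 + m) (formal_comp (f i) Th) (formal_comp (f i) id).
  apply: agree_compr => //; last exact: formal_id_vanish.
  by move=> k P /andP[_]; exact: dev_order.
rewrite -[f i]formal_comp1r -f_Th; last by rewrite addSn addnn ltnS.
rewrite formal_compBl F_lin formal_comp_diagr formal_comp_diagl //.
by rewrite /formal_sub mulrBl [cmonom _ _ * _]mulrC.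
Qed.

Lemma nonresonant_part_low j Q : (mdeg Q <= m)%N -> psi j Q = 0.
Proof. by move=> Qm; rewrite /nonresonant_part ltnNge Qm. Qed.

Lemma step_map_id : agree m.+1 Psi id.
Proof.
by move=> j Q Qm; rewrite /step_map /formal_add nonresonant_part_low ?addr0.
Qed.

Let Psi_id2 : agree 2 Psi id.
Proof. exact: agree_le _ step_map_id. Qed.

Lemma step_map_vanish : formal_vanish Psi.
Proof. exact: agree_vanish Psi_id2 formal_id_vanish. Qed.

Let invPsi_vanish : formal_vanish (formal_inv Psi).
Proof. exact: formal_inv_vanish. Qed.

Let Cr_id : agree m.+1 Cr id.
Proof.
by move=> j Q Qm; rewrite /formal_sub /resonant_part ltnNge -ltnS Qm subr0.
Qed.

Let Cr_vanish : formal_vanish Cr.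
Proof. exact: agree_vanish Cr_id formal_id_vanish. Qed.

(** Up to degree [2m], [Th - id] is unchanged by composition with [Cr], so [Th o Cr] is the identity
    plus [Th - id] minus its resonant part, that is, the step map; its inverse then leaves the
    identity. *)
Lemma step_linearization_id : agree m.*2.+1 Th' id.
Proof.
have ThC : agree m.*2.+1 (formal_comp Th Cr) Psi.
  rewrite -{1}(formal_subK id Th) formal_compDl formal_comp1l //.
  have th_C : agree (m.+1 + m) (formal_comp (formal_sub Th id) Cr)
      (formal_comp (formal_sub Th id) id).
    apply: agree_compr => //; last exact: formal_id_vanish.
    by move=> j Q /andP[_ Qm]; rewrite /formal_sub Th_id ?subrr.
  rewrite formal_comp1r addSn addnn in th_C.
  move=> j Q Qm; rewrite {1}/formal_add th_C //.
  rewrite /step_map /formal_add /formal_sub /psi /resonant_part.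
  have -> : (mdeg Q <= m.*2)%N by [].
  rewrite !andbT.
  have [Qm'|mQ] := leqP (mdeg Q) m; first by rewrite Th_id // subrr subr0.
  rewrite [id j Q]formal_diag_high; last exact: leq_ltn_trans mQ.
  by case: eqP; rewrite /= !subr0 !add0r // addNr.
rewrite /step_linearization -[X in agree _ _ X](formal_mulV Psi_id2).
by apply: agree_comp => //; [exact: formal_comp_vanish|exact: step_map_vanish].
Qed.

Lemma step_family_vanish i : formal_vanish (F' i).
Proof.
by do 2![apply: formal_comp_vanish => //]; exact: step_map_vanish.
Qed.

Let Cr_diag i : formal_comp (D i) Cr = formal_comp Cr (D i).
Proof.
rewrite formal_comp_diagl // formal_comp_diagr.
apply/funext => j; apply/funext => Q; rewrite mulrC.
rewrite {1 2}/formal_sub /formal_id /formal_diag /resonant_part.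
case: eqP => [->|_].
  by rewrite mdeg1 ltnNge m_gt0 /= subr0 !mul1r cmonom_mnm1.
case: ifP => [/andP[_ /eqP sd0]|_]; last by rewrite subr0 !mul0r.
by rewrite (small_divisor_eq0 i sd0).
Qed.

Lemma step_family_lin i : formal_comp (F' i) Th' = formal_comp Th' (D i).
Proof.
apply: (comp_conj (@formal_compA R n) (@formal_comp1l R n)
  (@formal_comp_vanish R n) _ _ _ _ _ _ _ _ (Cr_diag i)) => //.
- exact: step_map_vanish.
- exact: formal_diag_vanish.
- exact: formal_compV.
Qed.

Lemma step_conjugacy i : formal_comp Psi (F' i) = formal_comp (F i) Psi.
Proof.
apply: (comp_invK (@formal_compA R n) (@formal_comp1l R n)) => //.
  by apply: formal_comp_vanish => //; exact: step_map_vanish.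
exact: formal_compV.
Qed.

End NormalizationStep.

(** * Norm estimates for one normalization step *)

Section StepEstimates.
Variables (R : realType) (n l : nat) (mu : 'I_l -> 'I_n -> R[i]).
Variables (m : nat) (Th : formal_map R n) (F : 'I_l -> formal_map R n).
Hypothesis m_gt0 : (0 < m)%N.
Hypothesis Th_id : agree m.+1 Th (@formal_id R n).
Hypothesis F_vanish : forall i, formal_vanish (F i).
Hypothesis F_lin :
  forall i, formal_comp (F i) Th = formal_comp Th (formal_diag (mu i)).
Variables (w Lam lam : R).
Hypothesis w_gt0 : 0 < w.
Hypothesis w_le1 : w <= 1.
Hypothesis small_divisor_ge : forall Q j, (2 <= mdeg Q <= m.*2)%N ->
  small_divisor mu Q j != 0 -> w <= small_divisor mu Q j.
Hypothesis Lam_ge0 : 0 <= Lam.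
Hypothesis mu_le : forall i j, cmod (mu i j) <= Lam.
Hypothesis lam_gt0 : 0 < lam.
Hypothesis lam_le1 : lam <= 1.
Hypothesis mu_ge : forall i j, lam <= cmod (mu i j).

Local Notation D i := (formal_diag (mu i)).
Local Notation f i := (formal_sub (F i) (formal_diag (mu i))).
Local Notation psi := (nonresonant_part mu m Th).
Local Notation Psi := (step_map mu m Th).
Local Notation F' := (step_family mu m Th F).
Local Notation f' i := (formal_sub (F' i) (formal_diag (mu i))).

Let nonresonant_coef j Q : w * cmod (psi j Q) <= \sum_(i < l) cmod (f i j Q).
Proof.
have sum0 : 0 <= \sum_(i < l) cmod (f i j Q).
  by apply: sumr_ge0 => i _; exact: cmod_ge0.
rewrite /nonresonant_part; case: ifP => [/andP[Qm sd]|_]; last first.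
  by rewrite cmod0 mulr0.
have w_sd : w <= small_divisor mu Q j.
  apply: small_divisor_ge => //; case/andP: Qm => mQ ->; rewrite andbT.
  exact: leq_ltn_trans mQ.
apply: le_trans (ler_wpM2r (cmod_ge0 _)
  (le_trans w_sd (small_divisor_le_sum _ _ _))) _.
rewrite mulr_suml; apply: ler_sum => i _.
by rewrite -cmodM (cohomological_equation Th_id F_lin).
Qed.

Let nonresonant_eq i j Q : psi j Q != 0 ->
  psi j Q * cmonom (mu i) Q = f i j Q + mu i j * psi j Q.
Proof.
rewrite /nonresonant_part; case: ifP => [/andP[Qm sd] _|]; last by rewrite eqxx.
by rewrite (cohomological_equation Th_id F_lin) // mulrBl subrK mulrC.
Qed.

Section Radius.
Variables (rho : 'I_n -> R) (d : nat) (j : 'I_n) (a : R).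
Hypothesis rho0 : forall k, 0 <= rho k.
Hypothesis f_norm : forall i, trunc_norm rho d (f i j) <= a.

Lemma nonresonant_norm : trunc_norm rho d (psi j) <= l%:R * a / w.
Proof.
rewrite ler_pdivlMr // mulrC mulr_sumr.
apply: (@le_trans _ _ (\sum_(Q : 'X_{1..n < d})
    (\sum_(i < l) cmod (f i j Q) * weight rho Q))).
  apply: ler_sum => Q _; rewrite mulrA -mulr_suml.
  by apply: ler_wpM2r; [exact: weight_ge0|exact: nonresonant_coef].
rewrite exchange_big /=.
apply: (@le_trans _ _ (\sum_(i < l) a)).
  by apply: ler_sum => i _; exact: f_norm.
by rewrite sumr_const card_ord mulr_natl.
Qed.

Lemma nonresonant_norm_mu i :
  trunc_norm (fun k => cmod (mu i k) * rho k) d (psi j) <=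
  a + Lam * (l%:R * a / w).
Proof.
apply: (@le_trans _ _
    (trunc_norm rho d (f i j) + Lam * trunc_norm rho d (psi j))); last first.
  by rewrite lerD // ler_wpM2l // nonresonant_norm.
rewrite mulr_sumr -big_split /=; apply: ler_sum => Q _.
rewrite weightM -cmod_cmonom mulrA -cmodM mulrA -mulrDl.
apply: ler_wpM2r; first exact: weight_ge0.
have [->|psi0] := eqVneq (psi j Q) 0.
  by rewrite mul0r cmod0 mulr0 addr0 cmod_ge0.
rewrite nonresonant_eq //; apply: le_trans (ler_cmodD _ _) _.
by rewrite lerD2l cmodM ler_wpM2r ?cmod_ge0.
Qed.

End Radius.

Variables (g r a : R).
Hypothesis g_gt0 : 0 < g.
Hypothesis g_lt1 : g < 1.
Hypothesis g_w : ((1 + Lam) * l%:R + 1) * g ^+ m <= w / 2.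
Hypothesis r_gt0 : 0 < r.
Hypothesis a_ge0 : 0 <= a.
Hypothesis a_small : 2 * a <= lam * (g * (1 - g)) * r.
Hypothesis f_norm : forall d i j, trunc_norm (fun=> r) d (f i j) <= a.

Let g_ge0 : 0 <= g. Proof. exact: ltW. Qed.
Let g01 : 0 <= g <= 1. Proof. by rewrite g_ge0 ltW. Qed.
Let psi_low j Q : (mdeg Q < m)%N -> psi j Q = 0.
Proof. by move=> Qm; rewrite nonresonant_part_low // ltnW. Qed.

Let gm_ge0 : 0 <= g ^+ m. Proof. exact: exprn_ge0. Qed.

(* [(1 + Lam) * l + 1] dominates each of the three constants [l], [Lam * l] and
   [1 + Lam * l] by which the small divisors multiply [a]. *)
Let absorb c : c <= (1 + Lam) * l%:R + 1 -> g ^+ m * (c * a / w) <= a / 2.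
Proof.
move=> cK; have : c * g ^+ m <= w / 2.
  by apply: le_trans g_w; rewrite ler_wpM2r.
move=> cg; rewrite mulrA ler_pdivrMr // mulrCA mulrA [_ * w]mulrC.
by rewrite [leRHS]mulrCA mulrC ler_wpM2l.
Qed.

Let psi_norm d j : trunc_norm (fun=> g * r) d (psi j) <= a / 2.
Proof.
apply: le_trans (@trunc_norm_shrink _ _ (fun=> r) g m d _ _ g01 (@psi_low j)) _.
  by move=> k; rewrite ltW.
apply: le_trans
  (ler_wpM2l gm_ge0 (@nonresonant_norm (fun=> r) d j a _ _)) _ => //.
  by move=> k; rewrite ltW.
apply: absorb; rewrite mulrDl mul1r -addrA lerDl addr_ge0 //.
exact: mulr_ge0.
Qed.

Let Lam_psi_norm d j : Lam * trunc_norm (fun=> g * r) d (psi j) <= a / 2.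
Proof.
apply: le_trans (ler_wpM2l Lam_ge0
  (@trunc_norm_shrink _ _ (fun=> r) g m d _ _ g01 (@psi_low j))) _.
  by move=> k; rewrite ltW.
rewrite mulrCA.
apply: le_trans (ler_wpM2l gm_ge0 (ler_wpM2l Lam_ge0
  (@nonresonant_norm (fun=> r) d j a _ _))) _ => //.
  by move=> k; rewrite ltW.
have -> : Lam * (l%:R * a / w) = Lam * l%:R * a / w by ring.
apply: absorb; rewrite mulrDl mul1r -addrA addrCA lerDl addr_ge0 //.
Qed.

Let psi_norm_mu d i j :
  trunc_norm (fun k => cmod (mu i k) * (g * r)) d (psi j) <= a / 2.
Proof.
have mu_r k : 0 <= cmod (mu i k) * r by rewrite mulr_ge0 ?cmod_ge0 // ltW.
have -> : (fun k => cmod (mu i k) * (g * r)) = fun k => g * (cmod (mu i k) * r).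
  by apply/funext => k; rewrite mulrCA.
apply: le_trans (@trunc_norm_shrink _ _ _ g m d _ mu_r g01 (@psi_low j)) _.
apply: le_trans
  (ler_wpM2l gm_ge0 (@nonresonant_norm_mu (fun=> r) d j a _ _ i)) _ => //.
  by move=> k; rewrite ltW.
(* Since [w <= 1], the isolated [a] is at most [a / w], which brings the bound to the form handled
   by [absorb]. *)
apply: (@le_trans _ _ (g ^+ m * ((1 + Lam * l%:R) * a / w))).
  have -> : (1 + Lam * l%:R) * a / w = a / w + Lam * (l%:R * a / w) by ring.
  by rewrite ler_wpM2l // lerD2r ler_peMr // invf_ge1.
apply: absorb; rewrite [leRHS]addrC lerD2l ler_wpM2r //.
by rewrite lerDr.
Qed.

Let gg_le : g ^+ 2 * r <= g * r.
Proof. by rewrite ler_pM2r // expr2 ger_pMl // ltW. Qed.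

Let gg_ge0 : 0 <= g ^+ 2 * r. Proof. by rewrite mulr_ge0 ?sqr_ge0 // ltW. Qed.

Let psi_norm2 d j : trunc_norm (fun=> g ^+ 2 * r) d (psi j) <=
  trunc_norm (fun=> g * r) d (psi j).
Proof. by apply: ler_trunc_norm => k; rewrite gg_ge0 gg_le. Qed.

Let room : 2 * a <= (g * (1 - g)) * r.
Proof.
apply: le_trans a_small _; rewrite -mulrA ler_piMl //.
by rewrite mulr_ge0 ?mulr_ge0 ?subr_ge0 // ltW.
Qed.

Let step_map_norm2 d j : trunc_norm (fun=> g ^+ 2 * r) d (Psi j) <= r.
Proof.
apply: le_trans (trunc_normD _ _ _ _) _; first by [].
apply: (@le_trans _ _ (g ^+ 2 * r + a / 2)).
  apply: lerD; last exact: le_trans (psi_norm2 _ _) (psi_norm _ _).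
  apply: le_trans (trunc_norm_diag (fun=> 1) d j (fun=> gg_ge0)) _.
  by rewrite cmod1 mul1r.
have gr : g * r <= r by rewrite ger_pMl // ltW.
have := room; have -> : g * (1 - g) * r = g * r - g ^+ 2 * r by ring.
have := a_ge0; lra.
Qed.

Lemma step_map_norm d j : trunc_norm (fun=> g ^+ 3 * r) d (Psi j) <= r.
Proof.
apply: le_trans (step_map_norm2 d j); apply: ler_trunc_norm => k.
rewrite mulr_ge0 ?exprn_ge0 ?(ltW r_gt0) //= ler_wpM2r ?(ltW r_gt0) //.
by rewrite exprS ger_pMl ?exprn_gt0 // ltW.
Qed.

(** Expansion of [Psi o F' = F o Psi] with [Psi = id + psi] and [F = D + f]. Keeping [F'] implicit
    on the right avoids any estimate of the inverse of [Psi]. *)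
Let dev_eq i : f' i = fun j Q => mu i j * psi j Q +
  formal_comp (f i) Psi j Q - formal_comp psi (F' i) j Q.
Proof.
have Psi0 := step_map_vanish mu Th m_gt0.
have F'0 := step_family_vanish mu Th m_gt0 F_vanish i.
have := step_conjugacy mu Th m_gt0 F_vanish i.
rewrite {1}/step_map formal_compDl formal_comp1l // => conj.
apply/funext => j; apply/funext => Q.
have := congr1 (fun A => A j Q) conj.
rewrite -[in RHS](formal_subK (D i) (F i)) formal_compDl.
rewrite [in RHS]/formal_add formal_comp_diagl // /step_map {1 2}/formal_add.
rewrite /formal_sub mulrDr => /(canRL (addrK _)) ->.
have -> : mu i j * @formal_id R n j Q = D i j Q.
  by rewrite /formal_id /formal_diag; case: eqP; rewrite ?mulr1 ?mulr0.
rewrite [D i j Q + _]addrC -!addrA; congr (_ + _); rewrite addrCA; congr (_ + _).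
by rewrite addrCA subrr addr0.
Qed.

(** Induction on the truncation degree: the bound at [d] shows that [F'] maps the polydisc of radius
    [g^2 r] into the one of radii [|mu_k| g r], where [psi] is at most [a / 2], and this gives the
    bound at [d + 1] because [psi] starts at order 2. *)
Let dev_norm2 d i j : trunc_norm (fun=> g ^+ 2 * r) d (f' i j) <= 2 * a.
Proof.
have F'0 := step_family_vanish mu Th m_gt0 F_vanish i.
elim: d j => [|d IHd] j.
  by rewrite trunc_norm_deg0 mulr_ge0.
rewrite dev_eq; apply: le_trans (trunc_normB _ _ _ _) _; first by [].
(* The shares of [D o psi], [f o Psi] and [psi o F'], in this order. *)
have -> : 2 * a = a / 2 + a + a / 2 by field.
apply: lerD.
  apply: le_trans (trunc_normD _ _ _ _) _; first by [].
  apply: lerD.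
    rewrite trunc_normZ; apply: le_trans (Lam_psi_norm d.+1 j).
    by apply: ler_pM; rewrite ?cmod_ge0 ?trunc_norm_ge0.
  apply: le_trans (f_norm d.+1 i j); apply: trunc_norm_comp => //.
    exact: step_map_vanish.
apply: le_trans (psi_norm_mu d.+1 i j).
apply: trunc_norm_compS => //.
  move=> k Q Q1; apply: nonresonant_part_low.
  exact: leq_trans Q1 _.
move=> k; rewrite -(formal_subK (D i) (F' i)).
apply: le_trans (trunc_normD _ _ _ _) _; first by [].
apply: le_trans (lerD (trunc_norm_diag _ _ _ _) (IHd k)) _; first by [].
have := mu_ge i k; have := a_small; have := lam_gt0.
move: (cmod (mu i k)) => c lam0 al lc.
(* What has to fit is [c g^2 r + 2a <= c g r]. This is the origin of the room [g (1 - g)] in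
   [a_small], with [lam] bounding the moduli [c] from below. *)
suff : lam * (g * (1 - g)) * r <= c * (g * (1 - g)) * r by nra.
by rewrite !ler_wpM2r ?mulr_ge0 ?subr_ge0 // ltW.
Qed.

(** The new nonlinear part has order above [2m], so the third shrinking multiplies the bound [2a] by
    [g^(2m) <= 1/4]. *)
Lemma step_family_norm d i j :
  trunc_norm (fun=> g ^+ 3 * r) d (f' i j) <= a / 2.
Proof.
have f'_low Q : (mdeg Q < m.*2)%N -> f' i j Q = 0.
  move=> Qm; rewrite /formal_sub; apply/eqP; rewrite subr_eq0; apply/eqP.
  have F'_lin := step_family_lin m_gt0 Th_id F_vanish F_lin.
  apply: (family_diag (step_linearization_id mu m_gt0 Th_id) F'_lin).
  by rewrite ltnS ltnW.
have -> : (fun=> g ^+ 3 * r) = fun _ : 'I_n => g * (g ^+ 2 * r).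
  by apply/funext => k; rewrite exprS mulrA.
apply: le_trans
  (@trunc_norm_shrink _ _ (fun=> g ^+ 2 * r) g m.*2 d _ _ g01 f'_low) _.
  by [].
apply: le_trans (ler_wpM2l _ (dev_norm2 d i j)) _; first exact: exprn_ge0.
have gm : g ^+ m <= 1 / 2.
  apply: le_trans (_ : w / 2 <= _); last by rewrite ler_wpM2r.
  apply: le_trans g_w; rewrite ler_peMl // lerDr.
  by rewrite mulr_ge0 ?addr_ge0.
rewrite -addnn exprD.
apply: le_trans (ler_wpM2r _ (ler_pM gm_ge0 gm_ge0 gm gm)) _.
  by rewrite mulr_ge0.
by rewrite le_eqVlt; apply/orP; left; apply/eqP; field.
Qed.

End StepEstimates.

(** * The iteration with [m = 2^k], its formal limit and the bound on the limit *)

Section Iteration.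
Variables (R : realType) (n l : nat) (mu : 'I_l -> 'I_n -> R[i]).
Variables (A : 'I_l -> formal_map R n) (Th : formal_map R n).
Hypothesis A_vanish : forall i, formal_vanish (A i).
Hypothesis Th_id : agree 2 Th (@formal_id R n).
Hypothesis A_lin :
  forall i, formal_comp (A i) Th = formal_comp Th (formal_diag (mu i)).

Fixpoint newton k : formal_map R n * ('I_l -> formal_map R n) :=
  if k is k'.+1 then
    let: (T, F) := newton k' in
    (step_linearization mu (2 ^ k') T, step_family mu (2 ^ k') T F)
  else (Th, A).

Local Notation T k := (newton k).1.
Local Notation F k := (newton k).2.
Local Notation Psi k := (step_map mu (2 ^ k) (T k)).

Fixpoint newton_map k : formal_map R n :=
  if k is k'.+1 then formal_comp (newton_map k') (Psi k') else @formal_id R n.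

(** From stage [k] on, the factors only affect degrees above [2^k]; as [|Q| < 2^|Q|], the
    coefficient of index [Q] is final at stage [mdeg Q]. *)
Definition newton_limit : formal_map R n := fun j Q => newton_map (mdeg Q) j Q.

Let m_gt0 k : (0 < 2 ^ k)%N. Proof. by rewrite expn_gt0. Qed.

Let newtonS1 k : T k.+1 = step_linearization mu (2 ^ k) (T k).
Proof. by rewrite /=; case: (newton k). Qed.

Let newtonS2 k : F k.+1 = step_family mu (2 ^ k) (T k) (F k).
Proof. by rewrite /=; case: (newton k). Qed.

Lemma newton_vanish k i : formal_vanish (F k i).
Proof.
elim: k i => [|k IHk] i; first exact: A_vanish.
rewrite newtonS2; exact: step_family_vanish.
Qed.

Lemma newton_id k : agree (2 ^ k).+1 (T k) (@formal_id R n).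
Proof.
elim: k => [|k IHk]; first exact: Th_id.
by rewrite newtonS1 expnS mul2n; exact: step_linearization_id.
Qed.

Lemma newton_lin k i : formal_comp (F k i) (T k) =
  formal_comp (T k) (formal_diag (mu i)).
Proof.
elim: k i => [|k IHk] i; first exact: A_lin.
rewrite newtonS1 newtonS2; apply: step_family_lin => //; first exact: newton_id.
exact: newton_vanish.
Qed.

Lemma newton_map_vanish k : formal_vanish (newton_map k).
Proof.
elim: k => [|k IHk]; first exact: formal_id_vanish.
by apply: formal_comp_vanish => //; exact: step_map_vanish.
Qed.

Lemma newton_map_conj k i :
  formal_comp (A i) (newton_map k) = formal_comp (newton_map k) (F k i).
Proof.
elim: k => [|k IHk].
  rewrite [newton_map 0]/= formal_comp1r formal_comp1l //; exact: A_vanish.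
have PF : formal_comp (Psi k) (F k.+1 i) = formal_comp (F k i) (Psi k).
  by rewrite newtonS2; exact: step_conjugacy (m_gt0 k) (newton_vanish k) i.
exact: (comp_conj_trans (@formal_compA R n) (@newton_map_vanish k)
  (@newton_vanish k i) (step_map_vanish mu (T k) (m_gt0 k))
  (@newton_vanish k.+1 i) IHk PF).
Qed.

Lemma newton_map_agree k k' : (k <= k')%N ->
  agree (2 ^ k).+1 (newton_map k') (newton_map k).
Proof.
elim: k' => [|k' IHk']; first by rewrite leqn0 => /eqP->.
rewrite leq_eqVlt => /predU1P[->//|kk'].
apply: agree_trans _ (IHk' kk').
rewrite -[X in agree _ _ X]formal_comp1r /=.
apply: agree_comp => //; first exact: step_map_vanish.
  exact: formal_id_vanish.
apply: (@agree_le _ _ _ (2 ^ k').+1); first by rewrite ltnS leq_pexp2l.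
exact: step_map_id.
Qed.

Lemma newton_limit_agree k : agree (2 ^ k).+1 newton_limit (newton_map k).
Proof.
move=> j Q Qk; rewrite /newton_limit; have [kQ|Qk'] := leqP k (mdeg Q).
  exact: (newton_map_agree kQ).
by rewrite (newton_map_agree (ltnW Qk')) // ltnS ltnW // ltn_expl.
Qed.

Lemma newton_limit_id : agree 2 newton_limit (@formal_id R n).
Proof. exact: (@newton_limit_agree 0). Qed.

Lemma newton_limit_vanish : formal_vanish newton_limit.
Proof. exact: agree_vanish newton_limit_id (@formal_id_vanish R n). Qed.

(** Up to degree [2^d] the limit is [newton_map d], which conjugates [A i] to the family of stage
    [d], and the latter is [D_i] up to that degree. *)
Lemma newton_limit_lin i : formal_comp (A i) newton_limit =
  formal_comp newton_limit (formal_diag (mu i)).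
Proof.
apply: agreeP => d; apply: (@agree_le _ _ d (2 ^ d).+1).
  by rewrite ltnW // ltnS ltnW // ltn_expl.
have X0 := newton_limit_vanish; have XM := @newton_limit_agree d.
apply: agree_trans (agree_comp (@agree_refl _ _ _ (A i)) X0
  (@newton_map_vanish d) XM) _.
rewrite newton_map_conj; apply: agree_comp.
- exact: agree_sym.
- exact: newton_vanish.
- exact: formal_diag_vanish.
- exact: (@family_diag R n l mu (2 ^ d) (T d) (F d)
    (@newton_id d) (newton_lin d)).
Qed.

Variables (Lam lam a : R) (w g r : nat -> R) (rmin : R).
Hypothesis w_gt0 : forall k, 0 < w k.
Hypothesis w_le1 : forall k, w k <= 1.
Hypothesis small_divisor_ge : forall k Q j, (2 <= mdeg Q <= 2 ^ k.+1)%N ->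
  small_divisor mu Q j != 0 -> w k <= small_divisor mu Q j.
Hypothesis Lam_ge0 : 0 <= Lam.
Hypothesis mu_le : forall i j, cmod (mu i j) <= Lam.
Hypothesis lam_gt0 : 0 < lam.
Hypothesis lam_le1 : lam <= 1.
Hypothesis mu_ge : forall i j, lam <= cmod (mu i j).
Hypothesis g_gt0 : forall k, 0 < g k.
Hypothesis g_w : forall k,
  ((1 + Lam) * l%:R + 1) * g k ^+ (2 ^ k) <= w k / 2.
Hypothesis rS : forall k, r k.+1 = g k ^+ 3 * r k.
Hypothesis rmin_gt0 : 0 < rmin.
Hypothesis rmin_le : forall k, rmin <= r k.
Hypothesis a_ge0 : 0 <= a.
Hypothesis a_small : 4 * a <= lam * rmin.
Hypothesis A_norm : forall d i j,
  trunc_norm (fun=> r 0) d (formal_sub (A i) (formal_diag (mu i)) j) <= a.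

Let g_half k : g k ^+ (2 ^ k) <= 1 / 2.
Proof.
apply: le_trans (_ : w k / 2 <= _); last by rewrite ler_wpM2r.
have gm_ge0 : 0 <= g k ^+ (2 ^ k) by rewrite exprn_ge0 // ltW.
apply: le_trans (g_w k); rewrite ler_peMl // lerDr.
by rewrite mulr_ge0 ?addr_ge0.
Qed.

Let bernoulli (x : R) m : 0 <= x <= 1 -> 1 - m%:R * x <= (1 - x) ^+ m.
Proof.
case/andP=> x0 x1; elim: m => [|m IHm]; first by rewrite mul0r subr0 expr0.
rewrite exprS; apply: le_trans (ler_wpM2l _ IHm); last by rewrite subr_ge0.
have : 0 <= m%:R * x * x by rewrite !mulr_ge0.
rewrite -natr1; nra.
Qed.

(** Otherwise Bernoulli's inequality would give [g^(2^k) > 1/2]. A gap of order [2^-k] is enough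
    because the nonlinear parts are halved at each step. *)
Let g_gap k : g k <= 1 - (2 ^ k)%:R^-1 / 2.
Proof.
rewrite leNgt; apply/negP => gk; set x := (2 ^ k)%:R^-1 / 2 in gk.
have m0 : 0 < (2 ^ k)%:R :> R by rewrite ltr0n.
have x01 : 0 <= x <= 1.
  rewrite /x mulr_ge0 ?invr_ge0 ?ler0n //=.
  have : (2 ^ k)%:R^-1 <= 1 :> R by rewrite invf_le1 // ler1n.
  lra.
have x1 : 0 <= 1 - x by case/andP: x01; lra.
have : (1 - x) ^+ (2 ^ k) < g k ^+ (2 ^ k) by rewrite ltrXn2r // -lt0n.
have := bernoulli (2 ^ k) x01; have -> : (2 ^ k)%:R * x = 1 / 2.
  by rewrite /x mulrA divff ?lt0r_neq0.
by have := g_half k; lra.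
Qed.

Let g_lt1 k : g k < 1.
Proof.
apply: le_lt_trans (g_gap k) _; rewrite gtrBl.
by rewrite divr_gt0 // invr_gt0 ltr0n.
Qed.

Let r_gt0 k : 0 < r k. Proof. exact: lt_le_trans (rmin_le k). Qed.

(** As [r k.+1 <= g k * r k], the product [g k * r k] stays above [rmin], so the room is at least
    [lam * rmin * 2^-k / 2]; hence the constant 4 in [a_small]. *)
Let a_room k : 2 * (a / 2 ^+ k) <= lam * (g k * (1 - g k)) * r k.
Proof.
have gr : rmin <= g k * r k.
  apply: le_trans (rmin_le k.+1) _; rewrite rS ler_pM2r //.
  by rewrite exprS ger_pMr // exprn_ile1 // ltW.
have gap : (2 ^+ k)^-1 / 2 <= 1 - g k.
  by have := g_gap k; rewrite natrX; lra.
have x0 : 0 <= (2 ^+ k)^-1 :> R by rewrite invr_ge0 exprn_ge0.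
apply: (@le_trans _ _ (lam * rmin * ((2 ^+ k)^-1 / 2))).
  move: (2 ^+ k)^-1 x0 => x x0.
  have := ler_wpM2r x0 a_small; lra.
have -> : lam * (g k * (1 - g k)) * r k = lam * (g k * r k) * (1 - g k) by ring.
apply: ler_pM => //.
  by rewrite mulr_ge0 // ltW.
by rewrite ler_pM2l.
Qed.

Let small_divisor_double k Q j : (2 <= mdeg Q <= (2 ^ k).*2)%N ->
  small_divisor mu Q j != 0 -> w k <= small_divisor mu Q j.
Proof. by rewrite -mul2n -expnS; exact: small_divisor_ge. Qed.

Let ak_ge0 k : 0 <= a / 2 ^+ k.
Proof. by rewrite divr_ge0 ?exprn_ge0. Qed.

Let family_norm k d i j : trunc_norm (fun=> r k) d
  (formal_sub (F k i) (formal_diag (mu i)) j) <= a / 2 ^+ k.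
Proof.
elim: k d i j => [|k IHk] d i j; first by rewrite expr0 divr1.
rewrite newtonS2 rS [2 ^+ k.+1]exprSr invfM mulrA.
exact: (step_family_norm (m_gt0 k) (@newton_id k) (newton_vanish k)
  (newton_lin k) (w_gt0 k) (w_le1 k) (@small_divisor_double k) Lam_ge0 mu_le
  lam_gt0 lam_le1 mu_ge (g_gt0 k) (g_lt1 k) (g_w k) (r_gt0 k) (ak_ge0 k)
  (a_room k) IHk).
Qed.

(** No error accumulates: each step map sends the polydisc of radius [r k.+1] into the one of radius
    [r k]. *)
Lemma newton_map_norm k d j : trunc_norm (fun=> r k) d (newton_map k j) <= r 0.
Proof.
elim: k d j => [|k IHk] d j.
  apply: le_trans (trunc_norm_diag (fun=> 1) d j _) _.
    by move=> _; exact: ltW.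
  by rewrite cmod1 mul1r.
apply: le_trans (IHk d j); apply: trunc_norm_comp.
- by move=> _; exact: ltW.
- exact: step_map_vanish.
move=> i; rewrite rS.
exact: (step_map_norm (m_gt0 k) (@newton_id k) (newton_lin k) (w_gt0 k)
  (@small_divisor_double k) Lam_ge0 lam_le1 (g_gt0 k) (g_lt1 k) (g_w k) (r_gt0 k)
  (ak_ge0 k) (a_room k) (family_norm k)).
Qed.

Lemma newton_limit_norm d j : trunc_norm (fun=> rmin) d (newton_limit j) <= r 0.
Proof.
apply: le_trans (newton_map_norm d d j).
rewrite (@eq_trunc_norm _ _ _ _ _ (newton_map d j)).
  by apply: ler_trunc_norm => _; rewrite ltW //=.
move=> Q Qd; apply: newton_limit_agree; apply: leq_trans Qd _.
by rewrite ltnW // ltnS ltnW // ltn_expl.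
Qed.

End Iteration.

(** * The diophantine condition *)

Section DiophantineBound.
Variable R : realType.

(** The infinite sum is the limit of the partial sums, which is informative only when that limit
    exists. Here the gaps [c / 2^k - t k] are nonnegative and the geometric series converges: if
    some term were [-oo], or the sums of the gaps unbounded, the partial sums would tend to [-oo]
    and the negated sum would be [+oo]. *)
Lemma ereal_series_bounded (t : nat -> \bar R) (c : R) :
  (forall k, (0 < k)%N -> (t k <= (c / 2 ^+ k)%:E)%E) -> 0 <= c ->
  (- (\sum_(1 <= k <oo) t k) < +oo)%E ->
  (forall k, (0 < k)%N -> t k \is a fin_num) /\
  exists B, forall N, \sum_(1 <= k < N) (c / 2 ^+ k - fine (t k)) <= B.
Proof.
move=> tc c0 t_fin.
have notNy : ~ (fun N => \sum_(1 <= k < N) t k)%E @ \oo --> -oo%E.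
  by move/cvg_lim => limNy; move: t_fin; rewrite limNy //= ltxx.
have t_fin_num k : (0 < k)%N -> t k \is a fin_num.
  move=> k0; rewrite fin_numE; apply/andP; split; last first.
    by apply: contraTneq (tc k k0) => ->; rewrite leye_eq.
  apply/eqP => tk; apply: notNy; apply/cvgeNyPle => A.
  near=> N; rewrite (_ : \sum_(1 <= i < N) t i = -oo)%E ?leNye //.
  apply/esum_eqNyP; exists k; split => //.
  rewrite mem_index_iota k0 /=; near: N; exact: nbhs_infty_gt.
split=> //; apply: contrapT => unbounded; apply: notNy.
have TE N : (\sum_(1 <= k < N) t k)%E = (\sum_(1 <= k < N) fine (t k))%:E.
  rewrite -sumEFin; apply: eq_big_nat => k /andP[k0 _].
  by rewrite fineK // t_fin_num.
have v_ge0 k : (0 < k)%N -> 0 <= c / 2 ^+ k - fine (t k).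
  move=> k0; rewrite subr_ge0 -lee_fin fineK ?t_fin_num //; exact: tc.
have geo N : \sum_(1 <= k < N) (c / 2 ^+ k) <= c.
  apply: (@le_trans _ _ (c - c / 2 ^+ N.-1)).
    elim: N => [|N IHN]; first by rewrite big_geq // expr0 divr1 subrr.
    case: N IHN => [|N] IHN.
      by rewrite big_geq // expr0 divr1 subrr.
    rewrite big_nat_recr //=; apply: le_trans (lerD IHN (lexx _)) _.
    by rewrite /= exprSr invfM; lra.
  by rewrite gerBl divr_ge0 ?exprn_ge0.
apply/cvgeNyPle => A.
have [N0 vN0] : exists N0, c - A < \sum_(1 <= k < N0) (c / 2 ^+ k - fine (t k)).
  apply: contrapT => none; apply: unbounded; exists (c - A) => N.
  by rewrite leNgt; apply/negP => ?; apply: none; exists N.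
near=> N; rewrite TE lee_fin.
have N0N : (N0 <= N)%N by near: N; exact: nbhs_infty_ge.
have : c - A < \sum_(1 <= k < N) (c / 2 ^+ k - fine (t k)).
  apply: lt_le_trans vN0 _; have [N01|N01] := leqP 1 N0; last first.
    rewrite big_geq ?(leq_trans (ltnW N01)) // big_nat_cond sumr_ge0 // => k.
    by rewrite andbT => /andP[k0 _]; exact: v_ge0.
  rewrite [leRHS](big_cat_nat N01 N0N) /= lerDl big_nat_cond sumr_ge0 // => k.
  rewrite andbT => /andP[k0 _]; apply: v_ge0; exact: leq_trans k0.
rewrite sumrB; have := geo N; lra.
Unshelve. all: by end_near.
Qed.

Variables (n l : nat) (mu : 'I_l -> 'I_n -> R[i]).
Hypothesis mu_neq0 : forall i j, mu i j != 0.

(** The exponent [Q = 2 e_j] gives [mu_(i,j)^2 = mu_(i,j)], so all eigenvalues are 1. This isolates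
    the case where every [omega] is [+oo]; otherwise a nonzero divisor of degree 2 bounds all
    [omega_k], [k >= 1], from above. *)
Lemma small_divisor_trivial :
  (forall Q j, mdeg Q = 2%N -> small_divisor mu Q j = 0) ->
  forall Q j, small_divisor mu Q j = 0.
Proof.
move=> sd2; have mu1 i j : mu i j = 1.
  have Q2 : mdeg (U_(j) + U_(j) : 'X_{1..n})%MM = 2%N by rewrite mdegD mdeg1.
  have := small_divisor_eq0 i (sd2 _ j Q2).
  rewrite /cmonom (bigD1 j) //= big1 => [|k kj]; last first.
    by rewrite mnmDE mnm1E eq_sym (negbTE kj) expr0.
  rewrite mulr1 mnmDE mnm1E eqxx expr2 => mu2.
  by apply: (mulfI (mu_neq0 i j)); rewrite mulr1.
move=> Q j; apply/eqP; rewrite eq_le small_divisor_ge0 andbT.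
apply: bigmax_le => // i _; rewrite /cmonom big1 => [|k _].
  by rewrite mu1 subrr cmod0.
by rewrite mu1 expr1n.
Qed.

Lemma diophantine_bounded : diophantine mu -> exists w : nat -> R,
  [/\ forall k, 0 < w k, forall k, w k <= 1,
      forall k Q j, (2 <= mdeg Q <= 2 ^ k.+1)%N ->
        small_divisor mu Q j != 0 -> w k <= small_divisor mu Q j &
      exists B, forall N, \sum_(k < N) - ln (w k) / 2 ^+ k <= B].
Proof.
move=> dioph.
have [triv|] := pselect (forall Q j, mdeg Q = 2%N -> small_divisor mu Q j = 0).
  exists (fun=> 1); split=> // [k Q j _|].
    by rewrite (small_divisor_trivial triv) eqxx.
  by exists 0 => N; rewrite big1 // => k _; rewrite ln1 oppr0 mul0r.
move=> /existsNP[Q0 /existsNP[j0 /not_implyP[Q02 /eqP sd0]]].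
set s0 := small_divisor mu Q0 j0 in sd0.
have s0_gt0 : 0 < s0 by rewrite lt_neqAle eq_sym sd0 small_divisor_ge0.
(* A common upper bound of the [ln omega_k], [k >= 1], which makes the differences [c - ln omega_k]
   nonnegative. *)
pose c := `|ln s0|.
have omega_le k Q j : (2 <= mdeg Q <= 2 ^ k)%N -> small_divisor mu Q j != 0 ->
    (omega mu k <= (small_divisor mu Q j)%:E)%E.
  by move=> Qk sd; apply: ereal_inf_lbound; exists Q, j.
have omega_ge0 k : (0 <= omega mu k)%E.
  apply: le_ereal_inf_tmp => _ [Q [j [_ _ ->]]].
  by rewrite lee_fin small_divisor_ge0.
have omega_s0 k : (0 < k)%N -> (omega mu k <= s0%:E)%E.
  move=> k0; apply: omega_le => //; rewrite Q02 /=.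
  exact: (@leq_pexp2l 2 1 k).
have lne_le k : (0 < k)%N -> (lne (omega mu k) <= c%:E)%E.
  move=> k0; apply: (@le_trans _ _ (lne s0%:E)).
    rewrite lee_lne ?in_itv /= ?omega_ge0 ?leey ?omega_s0 //.
    by rewrite lee_fin (ltW s0_gt0).
  by rewrite lne_EFin // lee_fin ler_norm.
have [] := @ereal_series_bounded
  (fun k => lne (omega mu k) * ((2 ^+ k)^-1)%:E)%E c _ (normr_ge0 _) dioph.
  move=> k k0; rewrite EFinM; apply: lee_wpmul2r; last exact: lne_le.
  by rewrite lee_fin invr_ge0 exprn_ge0.
move=> lne_fin [B tB].
have o_real k : (0 < k)%N -> exists2 x : R, 0 < x & omega mu k = x%:E.
  move=> k0; have := omega_s0 k k0; have := omega_ge0 k; have := lne_fin k k0.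
  case: (omega mu k) => [x| |] //= lfin o_ge0 _; exists x => //.
  rewrite lt_neqAle -lee_fin o_ge0 andbT; apply: contraTneq lfin => oz.
  by rewrite -oz lexx mulNyr gtr0_sg ?invr_gt0 ?exprn_gt0 // mul1e.
pose o k := fine (omega mu k.+1).
have oE k : omega mu k.+1 = (o k)%:E.
  by have [x _ xE] := o_real k.+1 isT; rewrite /o xE.
have o_gt0 k : 0 < o k.
  by have [x x0 xE] := o_real k.+1 isT; rewrite /o xE.
exists (fun k => Num.min 1 (o k)); split.
- by move=> k; rewrite lt_min ltr01 o_gt0.
- by move=> k; rewrite ge_min lexx.
- move=> k Q j Qk sd; rewrite ge_min; apply/orP; right.
  by rewrite -lee_fin -oE; exact: omega_le.
(* [w k] comes from [omega mu k.+1], whose weight in the series is [2^-(k+1)]; the factor 2 restores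
   the weight [2^-k]. *)
exists (2 * B) => N.
apply: le_trans (ler_wpM2l (ler0n _ 2) (tB N.+1)); rewrite mulr_sumr.
rewrite big_add1 /= big_mkord; apply: ler_sum => k _.
rewrite oE lne_EFin // -EFinM /= exprS invfM.
have -> : 2 * (c * (2^-1 * 2 ^- k) - ln (o k) * (2^-1 * 2 ^- k)) =
    (c - ln (o k)) / 2 ^+ k by field; rewrite expf_neq0.
rewrite ler_wpM2r ?invr_ge0 ?exprn_ge0 //.
have lnc : ln (o k) <= c.
  by have := lne_le k.+1 isT; rewrite oE lne_EFin // lee_fin.
rewrite /Num.min; case: ifP => _; last by rewrite lerDr normr_ge0.
by rewrite ln1 oppr0 subr_ge0.
Qed.

End DiophantineBound.

(** * Convergent formal maps and their inverses *)

Section BoundedSeries.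
Variables (R : realType) (n : nat).
Implicit Types A B : formal_map R n.

(** Absolute convergence on some polydisc, expressed by finite sums with a bound uniform in the
    truncation degree. *)
Definition bounded_map A := exists s M : R, 0 < s /\
  forall d j, trunc_norm (fun=> s) d (A j) <= M.

Lemma trunc_norm_order2 (s r M : R) d (a : formal_series R n) :
  0 < s -> 0 <= r <= s -> (forall Q, (mdeg Q < 2)%N -> a Q = 0) ->
  trunc_norm (fun=> s) d a <= M -> trunc_norm (fun=> r) d a <= (r / s) ^+ 2 * M.
Proof.
move=> s0 /andP[r0 rs] a2 aM.
have rE : r = (r / s) * s by rewrite mulfVK ?lt0r_neq0.
have rs01 : 0 <= r / s <= 1.
  by rewrite divr_ge0 ?(ltW s0) //= ler_pdivrMr // mul1r.
rewrite {1}rE.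
apply: le_trans (@trunc_norm_shrink _ _ (fun=> s) _ 2 d a _ rs01 a2) _.
  by move=> _; exact: ltW.
by rewrite ler_wpM2l ?exprn_ge0 //; case/andP: rs01.
Qed.

Lemma bounded_map_diag mu : bounded_map (formal_diag mu).
Proof.
exists 1, (\sum_j cmod (mu j)); split=> // d j.
apply: le_trans (trunc_norm_diag mu d j (fun=> ler01)) _.
by rewrite mulr1 (bigD1 j) //= lerDl sumr_ge0 // => k _; exact: cmod_ge0.
Qed.

(** In [Y = id - x o Y] with [x = A - id] of order 2, the composite involves only coefficients of
    [Y] of lower degree, so a bound [2r] on the truncations of [Y] propagates from [d] to
    [d + 1]. *)
Lemma bounded_map_inv A : agree 2 A (@formal_id R n) -> bounded_map A ->
  bounded_map (formal_inv A).
Proof.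
move=> A_id [s [M [s0 AM]]].
pose x := formal_sub A (@formal_id R n); pose Y := formal_inv A.
(* The first bound on [r] keeps [2r] within the radius [s] of [x]; the second gives
   [(2r/s)^2 M1 <= r], so that [x o Y] adds at most [r] to the [r] of the identity. *)
pose M1 := `|M| + s; pose r := Num.min (s / 2) (s ^+ 2 / (4 * (M1 + 1))).
have M1_ge0 : 0 <= M1 by rewrite addr_ge0 // ltW.
have r0 : 0 < r.
  rewrite lt_min !divr_gt0 ?exprn_gt0 //= mulr_gt0 //.
  by rewrite ltr_wpDl.
have r2s : 2 * r <= s.
  have : r <= s / 2 by rewrite ge_min lexx.
  lra.
have rM1 : (2 * r / s) ^+ 2 * M1 <= r.
  have : r <= s ^+ 2 / (4 * (M1 + 1)) by rewrite ge_min lexx orbT.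
  have M10 : 0 < M1 + 1 by rewrite ltr_wpDl.
  rewrite ler_pdivlMr ?mulr_gt0 // => rs.
  have -> : (2 * r / s) ^+ 2 * M1 = (r * (4 * M1 * r)) / s ^+ 2.
    by field; rewrite lt0r_neq0.
  rewrite ler_pdivrMr ?exprn_gt0 // ler_wpM2l ?(ltW r0) //.
  by have := ltW r0; nra.
have A1 j Q : (mdeg Q < 2)%N -> x j Q = 0.
  by move=> Q2; rewrite /x /formal_sub A_id ?subrr.
have xM d j : trunc_norm (fun=> s) d (x j) <= M1.
  apply: le_trans (trunc_normB _ _ _ _) _; first by move=> _; exact: ltW.
  apply: lerD; first exact: le_trans (AM d j) (ler_norm _).
  apply: le_trans (trunc_norm_diag (fun=> 1) d j (fun=> ltW s0)) _.
  by rewrite cmod1 mul1r.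
have Y0 : formal_vanish Y := formal_inv_vanish A_id.
have YE j : Y j = fun Q => @formal_id R n j Q - formal_comp x Y j Q.
  have YxY : formal_add Y (formal_comp x Y) = @formal_id R n.
    by rewrite -{1}(formal_comp1l Y0) -formal_compDl formal_subK formal_compV.
  apply/funext => Q; have := congr1 (fun B => B j Q) YxY.
  by rewrite /formal_add => <-; rewrite addrK.
exists r, (2 * r); split=> //; elim=> [|d IHd] j.
  by rewrite trunc_norm_deg0 mulr_ge0 // ltW.
rewrite -/Y YE; apply: le_trans (trunc_normB _ _ _ _) _.
  by move=> _; exact: ltW.
have -> : 2 * r = r + r by ring.
apply: lerD.
  apply: le_trans (trunc_norm_diag (fun=> 1) d.+1 j (fun=> ltW r0)) _.
  by rewrite cmod1 mul1r.
apply: le_trans (@trunc_norm_compS _ _ _ (fun=> 2 * r) d x Y j _ A1 Y0 _) _.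
- by move=> _; exact: ltW.
- exact: IHd.
apply: le_trans rM1; apply: trunc_norm_order2 => //; last exact: A1.
by rewrite r2s mulr_ge0 // ltW.
Qed.

End BoundedSeries.

(** * Choice of the constants and existence of a convergent linearization *)

Section BoundedLinearization.
Variables (R : realType) (n l : nat) (mu : 'I_l -> 'I_n -> R[i]).
Variables (A : 'I_l -> formal_map R n) (Th : formal_map R n) (r1 M : R).
Hypothesis mu_neq0 : forall i j, mu i j != 0.
Hypothesis mu_diophantine : diophantine mu.
Hypothesis A_vanish : forall i, formal_vanish (A i).
Hypothesis Th_id : agree 2 Th (@formal_id R n).
Hypothesis A_lin :
  forall i, formal_comp (A i) Th = formal_comp Th (formal_diag (mu i)).
Hypothesis r1_gt0 : 0 < r1.
Hypothesis A_bounded : forall d i j, trunc_norm (fun=> r1) d (A i j) <= M.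

Let Lam := \sum_(i < l) \sum_(j < n) cmod (mu i j).

Let Lam_ge0 : 0 <= Lam.
Proof. by apply: sumr_ge0 => i _; apply: sumr_ge0 => j _; exact: cmod_ge0. Qed.

Let ler_sum2 (c : 'I_l -> 'I_n -> R) i j : (forall i j, 0 <= c i j) ->
  c i j <= \sum_(i < l) \sum_(j < n) c i j.
Proof.
move=> c0; rewrite (bigD1 i) //= (bigD1 j) //= -addrA lerDl addr_ge0 //.
  by apply: sumr_ge0.
by apply: sumr_ge0 => k _; apply: sumr_ge0.
Qed.

Let mu_le i j : cmod (mu i j) <= Lam.
Proof. by apply: (ler_sum2 (c := fun i j => _)) => ? ?; exact: cmod_ge0. Qed.

(** A sum of inverses in place of the least modulus needs no special case for an empty family; the
    added 1 gives [lam <= 1]. *)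
Let lam := (1 + \sum_(i < l) \sum_(j < n) (cmod (mu i j))^-1)^-1.

Let lam_sum_ge0 : 0 <= \sum_(i < l) \sum_(j < n) (cmod (mu i j))^-1.
Proof.
by apply: sumr_ge0 => i _; apply: sumr_ge0 => j _; rewrite invr_ge0 cmod_ge0.
Qed.

Let lam_gt0 : 0 < lam.
Proof. by rewrite invr_gt0 ltr_wpDr. Qed.

Let lam_le1 : lam <= 1.
Proof. by rewrite invf_le1 ?lerDl // ltr_wpDr. Qed.

Let mu_ge i j : lam <= cmod (mu i j).
Proof.
have c0 : 0 < cmod (mu i j) by rewrite lt_neqAle cmod_ge0 eq_sym cmod_eq0 mu_neq0.
rewrite -[leRHS]invrK lef_pV2 ?posrE ?invr_gt0 ?ltr_wpDr //.
apply: (@le_trans _ _ (\sum_(i < l) \sum_(j < n) (cmod (mu i j))^-1)).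
  by apply: (ler_sum2 (c := fun i j => (cmod (mu i j))^-1)) => ? ?;
    rewrite invr_ge0 cmod_ge0.
by rewrite lerDr.
Qed.

Let K := (1 + Lam) * l%:R + 1.

Let K_ge1 : 1 <= K.
Proof. by rewrite lerDr mulr_ge0 ?addr_ge0. Qed.

Lemma bounded_linearization : exists X : formal_map R n,
  [/\ agree 2 X (@formal_id R n), bounded_map X &
    forall i, formal_comp (A i) X = formal_comp X (formal_diag (mu i))].
Proof.
have [w [w_gt0 w_le1 w_sd [B wB]]] := diophantine_bounded mu_neq0 mu_diophantine.
have K2_gt0 : 0 < 2 * K by rewrite mulr_gt0 // (lt_le_trans ltr01).
(* Solves [K * g k ^+ (2 ^ k) = w k / 2], the weakest shrinking that the estimates allow. *)
pose g k := expR ((ln (w k) - ln (2 * K)) / 2 ^+ k).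
have g_w k : K * g k ^+ (2 ^ k) <= w k / 2.
  rewrite -expRM_natr natrX mulfVK ?expf_neq0 // expRD expRN !lnK ?posrE //.
  rewrite le_eqVlt; apply/orP; left; apply/eqP; field.
  by rewrite lt0r_neq0 // (lt_le_trans ltr01).
(* [B] bounds the sums of [- ln (w i) / 2^i] and 2 bounds those of [2^-i]; the cube accounts for the
   three shrinkings of a step. *)
pose G := expR (- B - 2 * ln (2 * K)) ^+ 3.
have G_gt0 : 0 < G by rewrite exprn_gt0 // expR_gt0.
have prod_g k : expR (- B - 2 * ln (2 * K)) <= \prod_(i < k) g i.
  rewrite -expR_sum ler_expR.
  under eq_bigr do rewrite mulrBl.
  rewrite sumrB; apply: lerB.
    rewrite lerNl -sumrN; apply: le_trans (wB k).
    by apply: ler_sum => i _; rewrite mulNr.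
  rewrite -mulr_sumr mulrC ler_wpM2r //.
    by rewrite ln_ge0 // (le_trans K_ge1) // ler_peMl ?ler1n // (le_trans ler01).
  suff -> : \sum_(i < k) (2 ^+ i)^-1 = 2 - 2 / 2 ^+ k :> R.
    by rewrite gerBl divr_ge0 ?exprn_ge0.
  elim: k => [|k IHk]; first by rewrite big_ord0 expr0 divr1 subrr.
  by rewrite big_ord_recr /= IHk exprS; field; rewrite expf_neq0.
(* The nonlinear parts have order 2, so at radius [r0 <= r1] they are at most [r0^2 * M2], whereas
   the required room is linear in [r0]: a small [r0] is enough. *)
pose M2 := (`|M| + Lam * r1) / r1 ^+ 2.
have M2_ge0 : 0 <= M2.
  by rewrite divr_ge0 ?exprn_ge0 ?addr_ge0 ?mulr_ge0 // ltW.
pose r0 := Num.min r1 (lam * G / (4 * (M2 + 1))).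
have M21_gt0 : 0 < 4 * (M2 + 1) by rewrite mulr_gt0 // ltr_wpDl.
have r0_gt0 : 0 < r0 by rewrite lt_min r1_gt0 divr_gt0 // mulr_gt0.
have r01 : r0 <= r1 by rewrite ge_min lexx.
pose r k := r0 * (\prod_(i < k) g i) ^+ 3.
have r00 : r 0 = r0 by rewrite /r big_ord0 expr1n mulr1.
have a_small : 4 * (r0 ^+ 2 * M2) <= lam * (r0 * G).
  have : r0 <= lam * G / (4 * (M2 + 1)) by rewrite ge_min lexx orbT.
  rewrite ler_pdivlMr // => rG.
  have -> : lam * (r0 * G) = r0 * (lam * G) by ring.
  have -> : 4 * (r0 ^+ 2 * M2) = r0 * (4 * M2 * r0) by ring.
  rewrite ler_wpM2l ?(ltW r0_gt0) //; apply: le_trans rG.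
  have := ltW r0_gt0; nra.
have A_norm d i j : trunc_norm (fun=> r 0) d
    (formal_sub (A i) (formal_diag (mu i)) j) <= r0 ^+ 2 * M2.
  have -> : r0 ^+ 2 * M2 = (r0 / r1) ^+ 2 * (`|M| + Lam * r1).
    by rewrite /M2; field; rewrite lt0r_neq0.
  rewrite r00; apply: trunc_norm_order2 => //; first by rewrite (ltW r0_gt0).
    move=> Q Q2; rewrite /formal_sub; apply/eqP; rewrite subr_eq0; apply/eqP.
    exact: (@family_diag _ _ _ mu 1 Th A Th_id A_lin).
  apply: le_trans (trunc_normB _ _ _ _) _; first by move=> _; exact: ltW.
  apply: lerD; first exact: le_trans (A_bounded d i j) (ler_norm _).
  apply: le_trans (trunc_norm_diag _ d j (fun=> ltW r1_gt0)) _.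
  by rewrite ler_wpM2r // ltW.
exists (newton_limit mu A Th); split.
- exact: newton_limit_id.
- exists (r0 * G), (r 0); split=> [|d j]; first exact: mulr_gt0.
  apply: (@newton_limit_norm _ _ _ mu A Th A_vanish Th_id A_lin Lam lam
    (r0 ^+ 2 * M2) w g r (r0 * G)) => //.
  + by move=> k; exact: expR_gt0.
  + move=> k; rewrite /r big_ord_recr /= exprMn; ring.
  + exact: mulr_gt0.
  + move=> k; rewrite /r ler_wpM2l ?(ltW r0_gt0) // lerXn2r ?nnegrE ?expR_ge0 //.
    exact: le_trans (expR_ge0 _) (prod_g k).
  + by rewrite mulr_ge0 ?exprn_ge0 // ltW.
- by move=> i; apply: newton_limit_lin.
Qed.

End BoundedLinearization.

(** * Convergent series and germs *)

Section ComplexTopology.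
Variable R : realType.
Local Notation C := R[i].

Lemma normE_cmod (z : C) : `|z| = (cmod z)%:C%C.
Proof. by []. Qed.

Lemma complex_gt0 (e : C) : 0 < e -> exists2 e' : R, 0 < e' & e = e'%:C%C.
Proof.
move=> e0; have eE := RRe_real (gtr0_real e0).
by exists (complex.Re e); rewrite ?eE // -ltcR eE.
Qed.

Lemma cvg_cmod (T : Type) (F : set_system T) (FF : Filter F) (u : T -> C)
    (z : C) :
  u @ F --> z <-> (fun t => cmod (u t - z)) @ F --> (0 : R).
Proof.
split=> [/cvgrPdist_lt uz|/cvgrPdist_lt uz]; apply/cvgrPdist_lt.
  move=> e e0; have /uz : 0 < e%:C%C :> C by rewrite ltcR.
  apply: filterS => t; rewrite normE_cmod ltcR => ze.
  by rewrite sub0r normrN ger0_norm ?cmod_ge0 // -cmodN opprB.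
move=> _ /complex_gt0[e e0 ->]; apply: filterS (uz _ e0) => t.
rewrite sub0r normrN ger0_norm ?cmod_ge0 // => ze.
by rewrite normE_cmod ltcR -cmodN opprB.
Qed.

Lemma cmod_squeeze (u : nat -> C) (v : C) (b : R^nat) :
  (forall d, cmod (u d - v) <= b d) -> b @ \oo --> 0 -> u @ \oo --> v.
Proof.
move=> ub b0; apply/cvg_cmod; apply: (@squeeze_cvgr _ _ _ _ (cst 0) b).
- by near=> d; rewrite cmod_ge0 ub.
- exact: cvg_cst.
- exact: b0.
Unshelve. all: by end_near.
Qed.

Lemma cmod_le_ReIm (z : C) : cmod z <= `|complex.Re z| + `|complex.Im z|.
Proof.
case: z => a b /=; have ab0 : 0 <= `|a| + `|b| by rewrite addr_ge0.
rewrite /cmod /= -[leRHS]ger0_norm // -sqrtr_sqr ler_wsqrtr // sqrrD.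
by rewrite !real_normK ?num_real // lerD2r lerDl mulrn_wge0 // mulr_ge0.
Qed.

Lemma Re_le_cmod (z : C) : `|complex.Re z| <= cmod z.
Proof.
case: z => a b; rewrite /cmod /= -sqrtr_sqr ler_wsqrtr // lerDl.
exact: sqr_ge0.
Qed.

Lemma Im_le_cmod (z : C) : `|complex.Im z| <= cmod z.
Proof.
case: z => a b; rewrite /cmod /= -sqrtr_sqr ler_wsqrtr // lerDr.
exact: sqr_ge0.
Qed.

(** Domination of the increments makes both [t] and [u + t] nondecreasing and bounded, and [u] is
    their difference. *)
Lemma real_dominated_cvg (u t : R^nat) (M : R) :
  (forall d e, (d <= e)%N -> `|u e - u d| <= t e - t d) ->
  (forall d, t d <= M) -> exists v : R, u @ \oo --> v.
Proof.
move=> ut tM.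
have t_cvg : cvgn t.
  apply: nondecreasing_is_cvgn.
    by move=> d e de; rewrite -subr_ge0; apply: le_trans (ut _ _ de).
  by exists M => _ [d _ <-]; exact: tM.
have ut_cvg : cvgn (u \+ t).
  apply: nondecreasing_is_cvgn.
    move=> d e de; have := ut _ _ de; rewrite ler_norml /= => /andP[h _].
    lra.
  exists (u 0 + M + (M - t 0)) => _ [d _ <-] /=.
  have := ut _ _ (leq0n d); rewrite ler_norml => /andP[_ h].
  have := tM d; lra.
exists (limn (u \+ t) - limn t).
have uE : u = (u \+ t) \- t by apply/funext => d /=; rewrite addrK.
by rewrite [X in X @ _]uE; exact: cvgB.
Qed.

Lemma cmod_dominated_cvg (u : nat -> C) (t : R^nat) (M : R) :
  (forall d e, (d <= e)%N -> cmod (u e - u d) <= t e - t d) ->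
  (forall d, t d <= M) -> exists v : C, u @ \oo --> v.
Proof.
move=> ut tM.
have [x ux] : exists x : R, (fun d => complex.Re (u d)) @ \oo --> x.
  apply: real_dominated_cvg tM => d e de; apply: le_trans (ut _ _ de).
  by rewrite -raddfB; exact: Re_le_cmod.
have [y uy] : exists y : R, (fun d => complex.Im (u d)) @ \oo --> y.
  apply: real_dominated_cvg tM => d e de; apply: le_trans (ut _ _ de).
  by rewrite -raddfB; exact: Im_le_cmod.
exists (x +i* y)%C.
have norm0 (f : R^nat) (z : R) :
    f @ \oo --> z -> (fun d => `|f d - z|) @ \oo --> 0.
  move=> fz; rewrite -[X in _ --> X](normr0 R) -(subrr z).
  by apply: cvg_norm; apply: cvgB => //; exact: cvg_cst.
have sum0 : (fun d => `|complex.Re (u d) - x| + `|complex.Im (u d) - y|) @ \oo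
    --> (0 : R).
  by rewrite -[X in _ --> X](addr0 0); apply: cvgD; exact: norm0.
apply: (cmod_squeeze _ sum0) => d; apply: le_trans (cmod_le_ReIm _) _.
by rewrite !raddfB.
Qed.

Lemma cvg_cmod_le (u : nat -> C) (v : C) (s : R) :
  u @ \oo --> v -> (forall d, cmod (u d) <= s) -> cmod v <= s.
Proof.
move=> /cvg_cmod uv us; apply/ler_addgt0Pl => e e0.
have /cvgrPdist_lt /(_ e e0)[N _ /(_ N (leqnn N))] := uv.
rewrite sub0r normrN ger0_norm ?cmod_ge0 // => uvN.
have -> : v = - (u N - v) + u N by rewrite opprB subrK.
apply: le_trans (ler_cmodD _ _) _; rewrite cmodN; apply: lerD => //.
exact: ltW.
Qed.

Variable n : nat.

(** Balls of the sup norm are polydiscs; their radius, an element of [R[i]], is replaced by a real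
    one. *)
Lemma near0_polydisc (P : 'rV[C]_n -> Prop) :
  (\forall x \near (0 : 'rV[C]_n), P x) <->
  exists2 r : R, 0 < r & forall x : 'rV[C]_n, (forall j, cmod (x 0 j) < r) -> P x.
Proof.
split=> [/nbhs_ballP[_ /= /complex_gt0[r r0 ->] rP]|[r r0 rP]].
  exists r => // x xr; apply: rP; split=> [|i j]; first by rewrite ltcR.
  by rewrite ord1 mxE /ball /= sub0r normrN normE_cmod ltcR.
apply/nbhs_ballP; exists r%:C%C; first by rewrite /= ltcR.
move=> x [_ xr]; apply: rP => j; have := xr 0 j.
by rewrite mxE /ball /= sub0r normrN normE_cmod ltcR.
Qed.

End ComplexTopology.

(** * Sums of power series and of their composites *)

Section SeriesSums.
Variables (R : realType) (n : nat).
Local Notation C := R[i].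
Implicit Types (a : formal_series R n) (z y : 'I_n -> C) (p : {mpoly C[n]}).

Definition partial_sum a z d : C := \sum_(Q : 'X_{1..n < d}) a Q * cmonom z Q.

Lemma partial_sum_meval a z d : partial_sum a z d = (series_trunc d a).@[z].
Proof.
rewrite /series_trunc raddf_sum; apply: eq_bigr => Q _ /=.
by rewrite mevalZ mevalX.
Qed.

Lemma cmod_meval z p : cmod p.@[z] <= poly_norm (fun j => cmod (z j)) p.
Proof.
rewrite mevalE; apply: le_trans (ler_cmod_sum _ _ _) _.
by apply: ler_sum => Q _; rewrite cmodM -cmod_cmonom.
Qed.

Lemma cmod_partial_sum a z d :
  cmod (partial_sum a z d) <= trunc_norm (fun j => cmod (z j)) d a.
Proof.
by rewrite partial_sum_meval -poly_norm_trunc //; exact: cmod_meval.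
Qed.

Lemma big_deg_widen (V : nmodType) (G : 'X_{1..n} -> V) d e : (d <= e)%N ->
  \sum_(Q : 'X_{1..n < d}) G Q = \sum_(Q : 'X_{1..n < e} | (mdeg Q < d)%N) G Q.
Proof.
move=> de; apply: (big_sub_widen 'X_{1..n < d} 'X_{1..n < e} xpredT) => Q Qd.
exact: leq_trans de.
Qed.

Lemma partial_sum_increment a z d e : (d <= e)%N ->
  cmod (partial_sum a z e - partial_sum a z d) <=
  trunc_norm (fun j => cmod (z j)) e a - trunc_norm (fun j => cmod (z j)) d a.
Proof.
move=> de; rewrite /partial_sum /trunc_norm.
rewrite (big_deg_widen (fun Q => a Q * cmonom z Q) de).
rewrite (big_deg_widen (fun Q => cmod (a Q) * weight _ Q) de).
rewrite (bigID (fun Q : 'X_{1..n < e} => (mdeg Q < d)%N)) /= addrC addrK.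
rewrite [X in _ <= X - _](bigID (fun Q : 'X_{1..n < e} => (mdeg Q < d)%N)) /=.
rewrite [leRHS]addrC addKr; apply: le_trans (ler_cmod_sum _ _ _) _.
by apply: ler_sum => Q _; rewrite cmodM cmod_cmonom.
Qed.

Section Convergence.
Variables (a : formal_series R n) (z : 'I_n -> C) (s M : R).
Hypothesis z_le : forall j, cmod (z j) <= s.
Hypothesis aM : forall d, trunc_norm (fun=> s) d a <= M.

Let z_norm d : trunc_norm (fun j => cmod (z j)) d a <= M.
Proof.
apply: le_trans (aM d); apply: ler_trunc_norm => j.
by rewrite cmod_ge0 z_le.
Qed.

Lemma series_converges : exists v : C, partial_sum a z @ \oo --> v.
Proof. pose t d := trunc_norm (fun j => cmod (z j)) d a.
by apply: (@cmod_dominated_cvg _ _ t M) => //; exact: partial_sum_increment. Qed.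

Lemma series_summable :
  summable [set: 'X_{1..n}] (fun Q => (cmod (a Q * cmonom z Q))%:E).
Proof.
apply: (@le_lt_trans _ _ M%:E); last exact: ltry.
apply: ge_ereal_sup => _ [X [finX _] <-]; rewrite fsbig_finite //=.
set r := finmap.enum_fset _; pose d := (\max_(Q <- r) (mdeg Q).+1)%N.
have rd Q : Q \in r -> (mdeg Q < d)%N.
  by move=> Qr; rewrite /d (big_rem Q) //= leq_max leqnn.
rewrite (big_mksub 'X_{1..n < d}) //=; last exact: finmap.fset_uniq.
apply: (@le_trans _ _ (trunc_norm (fun j => cmod (z j)) d a)%:E).
  rewrite (eq_bigr (fun Q : 'X_{1..n < d} => (cmod (a Q * cmonom z Q))%:E)).
    rewrite sumEFin lee_fin /trunc_norm.
    rewrite [leRHS](bigID (fun Q : 'X_{1..n < d} => val Q \in r)) /=.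
    rewrite ler_wpDr ?sumr_ge0 // => [Q _|].
      by rewrite mulr_ge0 ?cmod_ge0 // weight_ge0 // => j; exact: cmod_ge0.
    by apply: ler_sum => Q _; rewrite cmodM cmod_cmonom.
  by move=> Q _; rewrite ger0_norm ?cmod_ge0.
by rewrite lee_fin.
Qed.

End Convergence.

Lemma summable_bounded a z :
  summable [set: 'X_{1..n}] (fun Q => (cmod (a Q * cmonom z Q))%:E) ->
  exists M, forall d, trunc_norm (fun j => cmod (z j)) d a <= M.
Proof.
rewrite summableE; set S := esum _ _ => S_fin; exists (fine S) => d.
rewrite -lee_fin fineK //; apply: esum_ge.
pose r := [seq val Q | Q <- enum {: 'X_{1..n < d}}].
exists [set` r]; first by split=> //; exact: finite_seq.
have r_uniq : uniq r by rewrite map_inj_uniq; [exact: enum_uniq|exact: val_inj].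
rewrite -fsbig_seq //.
rewrite /r big_map big_enum /= /trunc_norm -sumEFin le_eqVlt; apply/orP; left.
apply/eqP/eq_bigr => Q _.
by rewrite ger0_norm ?cmod_ge0 // cmodM cmod_cmonom.
Qed.

Lemma meval_order_small z p (r : R) d : 0 <= r ->
  (forall j, cmod (z j) <= r / 2) -> poly_order_ge d p ->
  cmod p.@[z] <= 2^-1 ^+ d * poly_norm (fun=> r) p.
Proof.
move=> r0 zr dp; apply: le_trans (cmod_meval _ _) _.
rewrite !(poly_normE (d := msize p)) //.
apply: (@le_trans _ _ (trunc_norm (fun=> 2^-1 * r) (msize p) (fun Q => p@_Q))).
  by apply: ler_trunc_norm => j; rewrite cmod_ge0 mulrC zr.
apply: (@trunc_norm_shrink _ _ (fun=> r)) => //.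
by rewrite invr_ge0 ler0n invf_le1 ?ltr0n // ler1n.
Qed.

Section Lipschitz.
Variables (y y' : 'I_n -> C) (s : R).
Hypothesis y_le : forall k, cmod (y k) <= s.
Hypothesis y'_le : forall k, cmod (y' k) <= s.
Hypothesis s_ge0 : 0 <= s.

Let delta := \sum_k cmod (y k - y' k).

Let lip (x x' : C) (N : nat) := [/\ cmod x <= s ^+ N, cmod x' <= s ^+ N &
  s * cmod (x - x') <= N%:R * s ^+ N * delta].

Let lipM x x' N w w' L : lip x x' N -> lip w w' L ->
  lip (x * w) (x' * w') (N + L).
Proof.
move=> [xs xs' xx'] [ws ws' ww'].
split; [by rewrite exprD cmodM ler_pM ?cmod_ge0..|].
have -> : x * w - x' * w' = x * (w - w') + (x - x') * w'.
  by rewrite mulrBr mulrBl addrA subrK.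
apply: le_trans (ler_wpM2l s_ge0 (ler_cmodD _ _)) _; rewrite !cmodM mulrDr.
have -> : (N + L)%:R * s ^+ (N + L) * delta = s ^+ N * (L%:R * s ^+ L * delta) +
    N%:R * s ^+ N * delta * s ^+ L by rewrite natrD exprD; ring.
apply: lerD; first by rewrite mulrCA ler_pM ?cmod_ge0 ?mulr_ge0 ?cmod_ge0.
by rewrite mulrA ler_pM ?cmod_ge0 ?mulr_ge0 ?cmod_ge0.
Qed.

Let lip1 : lip 1 1 0.
Proof. by split; rewrite ?cmod1 ?expr0 // subrr cmod0 mulr0 mul0r mul0r. Qed.

Let delta_ge k : cmod (y k - y' k) <= delta.
Proof.
by rewrite /delta (bigD1 k) //= lerDl sumr_ge0 // => i _; exact: cmod_ge0.
Qed.

(** Telescoping gives [|y^Q - y'^Q| <= |Q| s^(|Q|-1) delta]. The factor [s] on the left avoids the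
    exponent [|Q| - 1], and [|Q| <= 2^|Q|] turns the degree into a doubled radius. *)
Lemma cmonom_lipschitz Q :
  s * cmod (cmonom y Q - cmonom y' Q) <= (2 * s) ^+ mdeg Q * delta.
Proof.
have [_ _] : lip (cmonom y Q) (cmonom y' Q) (mdeg Q).
  rewrite mdegE; apply: (big_ind3 lip) => [||k _]; [exact: lip1|exact: lipM|].
  elim: (Q k) => [|e IHe]; first by rewrite !expr0; exact: lip1.
  rewrite !exprS -add1n; apply: lipM => //; split; rewrite ?expr1 //.
  by rewrite mul1r ler_wpM2l.
move=> /le_trans; apply; rewrite exprMn; apply: ler_wpM2r.
  by apply: sumr_ge0 => k _; exact: cmod_ge0.
rewrite ler_wpM2r ?exprn_ge0 //.
by rewrite -natrX ler_nat ltnW // ltn_expl.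
Qed.

Lemma partial_sum_lipschitz a d :
  s * cmod (partial_sum a y d - partial_sum a y' d) <=
  trunc_norm (fun=> 2 * s) d a * delta.
Proof.
rewrite /partial_sum -sumrB mulr_suml.
apply: le_trans (ler_wpM2l s_ge0 (ler_cmod_sum _ _ _)) _.
rewrite mulr_sumr; apply: ler_sum => Q _.
rewrite -mulrBr cmodM weight_cst mulrCA -mulrA.
by rewrite ler_wpM2l ?cmod_ge0 ?cmonom_lipschitz.
Qed.

End Lipschitz.

Lemma cvg_sum0 (r : seq 'I_n) (f : 'I_n -> R^nat) :
  (forall k, f k @ \oo --> (0 : R)) ->
  (fun d => \sum_(k <- r) f k d) @ \oo --> (0 : R).
Proof.
move=> f0; elim: r => [|k r IHr].
  have -> : (fun d => \sum_(k <- [::]) f k d) = cst (0 : R).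
    by apply/funext => d; rewrite big_nil.
  exact: cvg_cst.
have -> : (fun d => \sum_(i <- k :: r) f i d) =
    (fun d => f k d + \sum_(i <- r) f i d).
  by apply/funext => d; rewrite big_cons.
by rewrite -[X in _ --> X](addr0 (0 : R)); apply: cvgD.
Qed.

(** The error has three parts. The truncated composite and the composite of the truncations differ
    by a polynomial of order [d], of size [2^-d] since [z] lies at half the radius; the partial sums
    of [A] at [yd d] and at [y] are close by the Lipschitz bound; those at [y] tend to [v]. *)
Lemma formal_comp_converges (A B : formal_map R n) j z y (v : C) (r s M : R) :
  0 < r -> 0 < s -> formal_vanish B ->
  (forall d k, trunc_norm (fun=> r) d (B k) <= s) ->
  (forall d, trunc_norm (fun=> 2 * s) d (A j) <= M) ->
  (forall k, cmod (z k) <= r / 2) ->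
  (forall k, partial_sum (B k) z @ \oo --> y k) ->
  partial_sum (A j) y @ \oo --> v ->
  partial_sum (formal_comp A B j) z @ \oo --> v.
Proof.
move=> r0 s0 B0 Bs AM zr By Av.
pose yd d k := partial_sum (B k) z d.
have yd_le d k : cmod (yd d k) <= s.
  apply: le_trans (cmod_partial_sum _ _ _) (le_trans _ (Bs d k)).
  apply: ler_trunc_norm => i; rewrite cmod_ge0 /= (le_trans (zr i)) //.
  by rewrite ler_pdivrMr // ler_peMr ?(ltW r0) // ler1n.
have y_le k : cmod (y k) <= s.
  by apply: cvg_cmod_le (By k) _ => d; exact: yd_le.
pose b d := 2 * M * 2^-1 ^+ d +
  (M / s * \sum_k cmod (yd d k - y k) + cmod (partial_sum (A j) y d - v)).
apply: (@cmod_squeeze _ _ _ b) => [d|]; last first.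
  rewrite -[X in _ --> X](addr0 0); apply: cvgD.
    apply: cvg_geometric; rewrite ger0_norm ?invr_ge0 //.
    by rewrite invf_lt1 // ltr1n.
  rewrite -[X in _ --> X](addr0 0); apply: cvgD; last exact/cvg_cmod.
  rewrite -[X in _ --> X](mulr0 (M / s)); apply: cvgM; first exact: cvg_cst.
  apply: (@cvg_sum0 _ (fun k d => cmod (yd d k - y k))) => k.
  by apply/cvg_cmod; exact: By.
rewrite /b.
pose p := series_trunc d (A j) \mPo [tuple series_trunc d (B k) | k < n].
have pE : p.@[z] = partial_sum (A j) (yd d) d.
  rewrite /p comp_mpoly_meval partial_sum_meval; apply: meval_eq => k.
  by rewrite tnth_mktuple /yd partial_sum_meval.
have pM : poly_norm (fun=> r) p <= M.
  apply: le_trans (poly_norm_comp (sigma := fun=> s) _ _ _) _.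
  - by move=> _; exact: ltW.
  - by move=> k; rewrite poly_norm_trunc //; exact: Bs.
  rewrite poly_norm_trunc; apply: le_trans (AM d); apply: ler_trunc_norm => _.
  by rewrite (ltW s0) /= ler_peMl ?(ltW s0) // ler1n.
rewrite -(subrKA (partial_sum (A j) (yd d) d)).
apply: le_trans (ler_cmodD _ _) (lerD _ _).
  pose q := series_trunc d (formal_comp A B j) - p.
  have -> : partial_sum (formal_comp A B j) z d - partial_sum (A j) (yd d) d =
      q.@[z] by rewrite mevalB -partial_sum_meval pE.
  apply: le_trans (meval_order_small (d := d) (ltW r0) zr _) _.
    move=> Q Qd; rewrite mcoeffB series_truncT // (formal_compE _ _ B0 Qd).
    exact: subrr.
  rewrite mulrC ler_wpM2r ?exprn_ge0 ?invr_ge0 //.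
  have qM : poly_norm (fun=> r) q <= poly_norm (fun=> r) (series_trunc d
      (formal_comp A B j)) + poly_norm (fun=> r) (-1 *: p).
    by rewrite /q -scaleN1r; apply: poly_normD => _; exact: ltW.
  apply: le_trans qM _; rewrite mulr2n mulrDl mul1r; apply: lerD.
    rewrite poly_norm_trunc; apply: le_trans pM.
    apply: trunc_norm_le_poly => [_|Q Qd]; first exact: ltW.
    exact: (formal_compE _ _ B0 Qd).
  apply: le_trans (poly_normZ _ _ _) _.
  by rewrite cmodN cmod1 mul1r.
rewrite -(subrKA (partial_sum (A j) y d)).
apply: le_trans (ler_cmodD _ _) (lerD _ (lexx _)).
rewrite mulrAC ler_pdivlMr // mulrC.
apply: le_trans (partial_sum_lipschitz (yd_le d) y_le (ltW s0) _ _) _.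
by rewrite ler_wpM2r // sumr_ge0 // => k _; exact: cmod_ge0.
Qed.

End SeriesSums.

(** * Germs and their Taylor expansions *)

Section Germs.
Variables (R : realType) (n : nat).
Local Notation C := R[i].
Local Notation Cn := 'rV[R[i]]_n.
Implicit Types (F G : Cn -> Cn) (A B : formal_map R n).

Lemma taylor_polydisc F A : taylor_expansion F A ->
  exists2 r : R, 0 < r & forall x : Cn, (forall j, cmod (x 0 j) < r) -> forall j,
    summable [set: 'X_{1..n}]
      (fun Q => (cmod (A j Q * cmonom (coordinates x) Q))%:E) /\
    partial_sum (A j) (coordinates x) @ \oo --> F x 0 j.
Proof.
move=> FA; pose P j (x : Cn) := summable [set: 'X_{1..n}]
    (fun Q => (cmod (A j Q * cmonom (coordinates x) Q))%:E) /\
  partial_sum (A j) (coordinates x) @ \oo --> F x 0 j.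
have nearP := @filter_forall _ _ P _ (nbhs_filter (0 : Cn)) FA.
have [r r0 FP] := (near0_polydisc (fun x => forall j, P j x)).1 nearP.
by exists r.
Qed.

(** Absolute summability at the single point with all coordinates [r / 2] is already a norm bound on
    the polydisc of that radius. *)
Lemma taylor_bounded F A : taylor_expansion F A -> bounded_map A.
Proof.
move=> /taylor_polydisc[r r0 FA]; pose x : Cn := const_mx (r / 2)%:C%C.
have xr j : cmod (x 0 j) = r / 2.
  by rewrite mxE /cmod /= expr0n addr0 sqrtr_sqr ger0_norm // divr_ge0 // ltW.
have x_lt j : cmod (x 0 j) < r.
  by rewrite xr ltr_pdivrMr // ltr_pMr // ltr1n.
have [M AM] := choice (fun j => summable_bounded (FA x x_lt j).1).
exists (r / 2), (\sum_j `|M j|); split; first exact: divr_gt0.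
move=> d j; have -> : (fun=> r / 2) = fun k => cmod (coordinates x k).
  by apply/funext => k; rewrite /coordinates xr.
apply: le_trans (AM j d) _; apply: le_trans (ler_norm _) _.
by rewrite (bigD1 j) //= lerDl sumr_ge0.
Qed.

Definition sum_map A : Cn -> Cn := fun x =>
  \row_j lim (partial_sum (A j) (coordinates x) @ \oo).

Lemma taylor_sum_map A : bounded_map A -> taylor_expansion (sum_map A) A.
Proof.
move=> [s [M [s0 AM]]] j; apply/near0_polydisc; exists s => // x xs.
have x_le k : cmod (coordinates x k) <= s := ltW (xs k).
split; first exact: series_summable x_le (fun d => AM d j).
rewrite mxE; have [v xv] := series_converges x_le (fun d => AM d j).
by apply: cvgP xv.
Qed.

Lemma taylor_comp F G A B : formal_vanish B -> taylor_expansion F A ->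
  taylor_expansion G B -> taylor_expansion (F \o G) (formal_comp A B).
Proof.
move=> B0 FA GB.
have [s1 [M [s1_gt0 AM]]] := taylor_bounded FA.
have [r1 [N [r1_gt0 BN]]] := taylor_bounded GB.
have [r2 r2_gt0 FAx] := taylor_polydisc FA.
have [r3 r3_gt0 GBx] := taylor_polydisc GB.
(* [2 * s <= s1] is needed by the Lipschitz bound for [A]; [s < r2] puts the values of [G] where the
   expansion of [F] holds. *)
pose s := Num.min (s1 / 2) (r2 / 2).
have s_gt0 : 0 < s by rewrite lt_min !divr_gt0.
have s_s1 : 2 * s <= s1.
  have : s <= s1 / 2 by rewrite ge_min lexx.
  lra.
have s_r2 : s < r2.
  have : s <= r2 / 2 by rewrite ge_min lexx orbT.
  lra.
have N1_gt0 : 0 < `|N| + 1 by rewrite ltr_wpDl.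
(* [B] has no constant term, so shrinking its radius by [c] shrinks its norm by [c] as well, to at
   most [s]. *)
pose c := Num.min 1 (s / (`|N| + 1)); pose r := c * r1.
have c_gt0 : 0 < c by rewrite lt_min ltr01 divr_gt0.
have c01 : 0 <= c <= 1 by rewrite ltW // ge_min lexx.
have r_gt0 : 0 < r by exact: mulr_gt0.
have Bs d k : trunc_norm (fun=> r) d (B k) <= s.
  have Bk Q : (mdeg Q < 1)%N -> B k Q = 0.
    by rewrite ltnS leqn0 mdeg_eq0 => /eqP->.
  apply: le_trans (@trunc_norm_shrink _ _ (fun=> r1) c 1 d _ _ c01 Bk) _.
    by move=> _; exact: ltW.
  rewrite expr1; apply: (@le_trans _ _ (s / (`|N| + 1) * `|N|)).
    apply: ler_pM; first exact: ltW.
    - by apply: trunc_norm_ge0 => _; exact: ltW.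
    - by rewrite ge_min lexx orbT.
    - exact: le_trans (BN d k) (ler_norm _).
  rewrite mulrAC ler_pdivrMr // ler_wpM2l ?(ltW s_gt0) //.
  by rewrite lerDl.
have AM2 j d : trunc_norm (fun=> 2 * s) d (A j) <= M.
  apply: le_trans (AM d j); apply: ler_trunc_norm => _.
  by rewrite s_s1 mulr_ge0 // ltW.
move=> j; apply/near0_polydisc; exists (Num.min (r / 2) r3).
  by rewrite lt_min r3_gt0 divr_gt0.
move=> x x_lt.
have x_r k : cmod (coordinates x k) <= r / 2.
  by have := x_lt k; rewrite lt_min => /andP[/ltW].
have x_r3 k : cmod (x 0 k) < r3 by have := x_lt k; rewrite lt_min => /andP[].
have r_half : r / 2 <= r by rewrite ler_pdivrMr // ler_peMr ?(ltW r_gt0) // ler1n.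
have Gx k := (GBx x x_r3 k).2.
have Gx_le k : cmod (G x 0 k) <= s.
  apply: cvg_cmod_le (Gx k) _ => d.
  apply: le_trans (cmod_partial_sum _ _ _) (le_trans _ (Bs d k)).
  by apply: ler_trunc_norm => i; rewrite cmod_ge0 /= (le_trans (x_r i)).
have Gx_lt k : cmod (G x 0 k) < r2 by exact: le_lt_trans (Gx_le k) s_r2.
split; last first.
  exact: (formal_comp_converges r_gt0 s_gt0 B0 Bs (AM2 j) x_r Gx
    (FAx _ Gx_lt j).2).
apply: (@series_summable _ _ _ _ r M) => [k|d]; first exact: le_trans (x_r k) _.
apply: le_trans (AM2 j d).
apply: le_trans (@trunc_norm_comp _ _ _ (fun=> s) d A B j _ B0 (Bs d)) _.
  by move=> _; exact: ltW.
apply: ler_trunc_norm => _.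
by rewrite (ltW s_gt0) /= ler_peMl ?(ltW s_gt0) // ler1n.
Qed.

Lemma taylor_unique F G A :
  taylor_expansion F A -> taylor_expansion G A -> germ_eq F G.
Proof.
move=> /taylor_polydisc[r r0 FA] /taylor_polydisc[r' r'0 GA].
apply/near0_polydisc; exists (Num.min r r'); first by rewrite lt_min r0.
move=> x xr; apply/rowP => j.
have xr1 k : cmod (x 0 k) < r by have := xr k; rewrite lt_min => /andP[].
have xr2 k : cmod (x 0 k) < r' by have := xr k; rewrite lt_min => /andP[].
by apply: cvg_unique (FA x xr1 j).2 (GA x xr2 j).2; exact: norm_hausdorff.
Qed.

Lemma partial_sum_eventually (a : formal_series R n) (z : 'I_n -> C) (v : C) :
  (forall d, partial_sum a z d.+2 = v) -> partial_sum a z @ \oo --> v.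
Proof.
by move=> av; apply: (@cvg_near_cst _ _ v); exists 2%N => // -[|[|d]] //= _.
Qed.

Lemma partial_sum_diag mu (z : 'I_n -> C) j d :
  partial_sum (formal_diag mu j) z d.+2 = mu j * z j.
Proof.
have Uj : (mdeg (U_(j)%MM : 'X_{1..n}) < d.+2)%N by rewrite mdeg1.
rewrite /partial_sum (bigD1 (BMultinom Uj)) //= /formal_diag eqxx cmonom_mnm1.
rewrite big1 ?addr0 // => Q QU; case: eqP => [QE|_]; last by rewrite mul0r.
by move: QU; rewrite -val_eqE /= QE eqxx.
Qed.

Lemma taylor_diag (mu : 'I_n -> C) :
  taylor_expansion (diag_map mu) (formal_diag mu).
Proof.
have [s [M [s0 DM]]] := bounded_map_diag mu.
move=> j; apply/near0_polydisc; exists s => // x xs; split.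
  by apply: series_summable (fun k => ltW (xs k)) (fun d => DM d j).
rewrite mxE; apply: partial_sum_eventually => d; exact: partial_sum_diag.
Qed.

Lemma diag_map1 : diag_map (fun=> 1) = id :> (Cn -> Cn).
Proof. by apply/funext => x; apply/rowP => j; rewrite mxE mul1r. Qed.

Lemma taylor_at0 F A j : taylor_expansion F A -> F 0 0 j = A j 0%MM.
Proof.
move=> /taylor_polydisc[r r0 /(_ 0)].
have x0 k : cmod ((0 : Cn) 0 k) < r by rewrite mxE cmod0.
move=> /(_ x0 j)[_ F0]; apply: cvg_unique F0 _; first exact: norm_hausdorff.
apply: partial_sum_eventually => d.
have d0 : (mdeg (0%MM : 'X_{1..n}) < d.+2)%N by rewrite mdeg0.
rewrite /partial_sum (bigD1 (BMultinom d0)) //= big1 => [|Q Q0].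
  rewrite addr0 /cmonom big1 ?mulr1 // => k _.
  by rewrite mnm0E expr0.
have [k Qk] : exists k, Q k != 0%N.
  apply/existsP; apply: contraNT Q0 => /existsPn Q0.
  by rewrite -val_eqE; apply/eqP/mnmP => k; rewrite mnm0E; apply/eqP/negPn/Q0.
rewrite /cmonom (bigD1 k) //= /coordinates mxE.
by rewrite expr0n (negbTE Qk) !(mul0r, mulr0).
Qed.

Lemma row_norm (x : Cn) : exists2 r : R, `|x| = r%:C%C &
  0 <= r /\ forall j, cmod (x 0 j) <= r.
Proof.
have x0 : 0 <= `|x| by exact: normr_ge0.
have xE := RRe_real (ger0_real x0); exists (complex.Re `|x|) => //.
split=> [|j]; first by rewrite -lecR xE.
rewrite -lecR xE -normE_cmod [leRHS]/Num.norm /= mx_normE.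
rewrite -[leLHS]nngE num_le.
exact: (@le_bigmax _ _ _ _ (fun i => `|x i.1 i.2|%:nng) (0, j)).
Qed.

Lemma row_norm_le (x : Cn) (t : R) : 0 <= t ->
  (forall j, cmod (x 0 j) <= t) -> `|x| <= t%:C%C.
Proof.
move=> t0 xt; have [->|] := eqVneq `|x| 0; first by rewrite lecR.
rewrite {1}/Num.norm /= => /mx_norm_neq0[[i j] /= xij].
by rewrite [leLHS]/Num.norm /= xij ord1 normE_cmod lecR.
Qed.

(** The terms of [A - id] have degree at least 2, so the shrinking estimate yields
    [F x - x = O(|x|^2)]. *)
Lemma taylor_is_diff F A : agree 2 A (@formal_id R n) ->
  taylor_expansion F A -> is_diff (0 : Cn) F id.
Proof.
move=> A_id FA; pose x0 := formal_sub A (@formal_id R n).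
have F0 : F 0 = 0.
  apply/rowP => j; rewrite (taylor_at0 j FA) mxE A_id ?mdeg0 //.
  exact: formal_id_vanish.
have [s [M [s0 AM]]] := taylor_bounded FA.
have [r r0 FAx] := taylor_polydisc FA.
have x0_low j Q : (mdeg Q < 2)%N -> x0 j Q = 0.
  by move=> Q2; rewrite /x0 /formal_sub A_id ?subrr.
pose M1 := `|M| + s.
have M1_gt0 : 0 < M1 by rewrite ltr_wpDl.
have x0M d j : trunc_norm (fun=> s) d (x0 j) <= M1.
  apply: le_trans (trunc_normB _ _ _ _) _; first by move=> _; exact: ltW.
  apply: lerD; first exact: le_trans (AM d j) (ler_norm _).
  apply: le_trans (trunc_norm_diag (fun=> 1) d j (fun=> ltW s0)) _.
  by rewrite cmod1 mul1r.
have quadratic (x : Cn) (t : R) : 0 <= t -> t <= s -> t < r ->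
    (forall j, cmod (x 0 j) <= t) -> `|F x - x| <= ((t / s) ^+ 2 * M1)%:C%C.
  move=> t0 ts tr xt; apply: row_norm_le.
    by rewrite mulr_ge0 ?sqr_ge0 // ltW.
  move=> j; have x_lt k : cmod (x 0 k) < r by exact: le_lt_trans (xt k) tr.
  have FxM : partial_sum (x0 j) (coordinates x) @ \oo --> (F x - x) 0 j.
    have -> : partial_sum (x0 j) (coordinates x) =
        partial_sum (A j) (coordinates x) \-
        partial_sum (@formal_id R n j) (coordinates x).
      apply/funext => d; rewrite /partial_sum /= -sumrB; apply: eq_bigr => Q _.
      by rewrite -mulrBl.
    rewrite !mxE; apply: cvgB; first exact: (FAx x x_lt j).2.
    apply: partial_sum_eventually => d.
    by rewrite /formal_id partial_sum_diag mul1r.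
  apply: cvg_cmod_le FxM _ => d; apply: le_trans (cmod_partial_sum _ _ _) _.
  apply: (@le_trans _ _ (trunc_norm (fun=> t) d (x0 j))).
    by apply: ler_trunc_norm => k; rewrite cmod_ge0 xt.
  by apply: trunc_norm_order2 => //; [rewrite t0|exact: x0_low].
have F_o : F \o shift 0 = cst (F 0) + (idfun : {linear Cn -> Cn}) +o_ (0 : Cn) id.
  apply/eqaddoP => _ /complex_gt0[e e0 ->].
  apply/near0_polydisc.
  (* The first two bounds make [quadratic] applicable; the third turns [(t / s)^2 * M1] into at most
     [e * t]. *)
  pose t0 := Num.min (Num.min s (r / 2)) (e * s ^+ 2 / M1).
  have t0_gt0 : 0 < t0.
    by rewrite !lt_min s0 !divr_gt0 // mulr_gt0 // exprn_gt0.
  exists t0 => // x x_lt.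
  have [t xE [t_ge0 xt]] := row_norm x.
  have t_le : t <= t0.
    rewrite -lecR -xE; apply: row_norm_le => [|j]; first exact: ltW.
    exact: ltW.
  have -> : (F \o shift 0 - (cst (F 0) + (idfun : {linear Cn -> Cn}))) x =
      F x - x.
    by rewrite /= F0 !fctE /= addr0 add0r.
  have [ts tr te] : [/\ t <= s, t <= r / 2 & t <= e * s ^+ 2 / M1].
    by move: t_le; rewrite !le_min => /andP[/andP[-> ->] ->].
  apply: le_trans (quadratic x t t_ge0 ts _ xt) _.
    by apply: le_lt_trans tr _; rewrite ltr_pdivrMr // ltr_pMr // ltr1n.
  rewrite xE -rmorphM lecR.
  move: te; rewrite ler_pdivlMr // => te.
  have -> : (t / s) ^+ 2 * M1 = t * (t * M1) / s ^+ 2.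
    by field; rewrite lt0r_neq0.
  rewrite ler_pdivrMr ?exprn_gt0 //.
  have -> : e * t * s ^+ 2 = t * (e * s ^+ 2) by ring.
  by rewrite ler_wpM2l.
have id_cont : continuous (idfun : {linear Cn -> Cn}) by move=> x; exact: cvg_id.
have dF := diff_unique id_cont F_o.
apply: DiffDef; last exact: dF.
by apply/diff_locallyP; rewrite dF; split.
Qed.

Lemma bounded_family l (A : 'I_l -> formal_map R n) :
  (forall i, bounded_map (A i)) ->
  exists r M : R, 0 < r /\ forall d i j, trunc_norm (fun=> r) d (A i j) <= M.
Proof.
move=> /choice[s /choice[M AM]].
exists (\big[Num.min/1]_i s i), (\sum_i `|M i|); split.
  by apply: lt_bigmin => // i _; have [] := AM i.
move=> d i j; apply: (@le_trans _ _ (M i)).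
  apply: le_trans ((AM i).2 d j); apply: ler_trunc_norm => _.
  rewrite bigmin_le_cond // andbT.
  by apply: le_bigmin => [//|k _]; exact: ltW (AM k).1.
apply: le_trans (ler_norm _) _.
by rewrite (bigD1 i) //= lerDl sumr_ge0.
Qed.

End Germs.

(** * From formal series back to germs *)

Theorem corollary2p2 (R : realType) (n l : nat)
  (F f : 'I_l -> 'rV[R[i]]_n -> 'rV[R[i]]_n) (mu : 'I_l -> 'I_n -> R[i])
  (F_diffeo : forall i, holo_diffeo (F i))
  (F_abelian : forall i i', germ_eq (F i \o F i') (F i' \o F i))
  (FE : forall i, germ_eq (F i) (fun x => diag_map (mu i) x + f i x))
  (f0 : forall i, f i 0 = 0)
  (df0 : forall i, is_diff (0 : 'rV[R[i]]_n) (f i) 0)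
  (mu_neq0 : forall i j, mu i j != 0)
  (mu_diophantine : diophantine mu)
  (F_formal : formally_linearizable F mu) :
  holomorphically_linearizable F mu.
Proof.
have [A [FA [Phi [Psi [[Phi0 Psi0 PsiPhi PhiPsi] Phi_tan A_conj]]]]] := F_formal.
have F0 i : F i 0 = 0.
  have /nbhs_singleton -> := FE i; rewrite f0 addr0.
  by apply/rowP => j; rewrite !mxE mulr0.
have A0 i : formal_vanish (A i).
  by move=> j; rewrite -(taylor_at0 j (FA i)) F0 mxE.
have Phi_id : agree 2 Phi (@formal_id R n).
  move=> j Q; rewrite ltnS leq_eqVlt ltnS leqn0 mdeg_eq0.
  case/orP=> [/mdeg1P[k /eqP->]|/eqP->]; last first.
    by rewrite Phi0 formal_id_vanish.
  by rewrite Phi_tan /formal_id /formal_diag eq_mnm1 eq_sym; case: eqP.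
have Psi_id : agree 2 Psi (@formal_id R n).
  by rewrite (formal_inv_unique Phi_id Psi0 PsiPhi); exact: formal_inv_id.
(* The iteration takes linearizations in the form [A o Th = Th o D], so it starts from the inverse
   [Psi] of the linearizing map. *)
have A_lin i : formal_comp (A i) Psi = formal_comp Psi (formal_diag (mu i)).
  have APsi0 := formal_comp_vanish (A0 i) Psi0.
  rewrite -A_conj.
  by rewrite (comp_invK (@formal_compA R n) (@formal_comp1l R n) Phi0 APsi0).
have [r [M [r_gt0 AM]]] := bounded_family (fun i => taylor_bounded (FA i)).
have [X [X_id X_bounded A_X]] :=
  bounded_linearization mu_neq0 mu_diophantine A0 Psi_id A_lin r_gt0 AM.
have X0 : formal_vanish X := agree_vanish X_id (@formal_id_vanish R n).
have Y0 := formal_inv_vanish X_id.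
have SX := taylor_sum_map X_bounded.
have SY := taylor_sum_map (bounded_map_inv X_id X_bounded).
have Sid := taylor_diag (fun=> 1) : taylor_expansion _ (@formal_id R n).
rewrite diag_map1 in Sid.
have S0 B : formal_vanish B -> taylor_expansion (sum_map B) B -> sum_map B 0 = 0.
  by move=> B0 SB; apply/rowP => j; rewrite (taylor_at0 j SB) B0 mxE.
(* [X] maps the linearizing coordinates to the original ones, so the linearizing germ is the sum of
   its inverse. The germ identities follow from the formal ones because germs with the same Taylor
   expansion coincide. *)
exists (sum_map (formal_inv X)), (sum_map X); split.
- split.
  + by split; [exists (formal_inv X)|exists X].
  + by split; exact: S0.
  + by apply: taylor_unique Sid; rewrite -(formal_compV X_id); exact: taylor_comp.
  + by apply: taylor_unique Sid; rewrite -(formal_mulV X_id); exact: taylor_comp.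
- exact: taylor_is_diff (formal_inv_id X_id) SY.
move=> i; apply: taylor_unique (taylor_diag (mu i)).
have YX := formal_mulV X_id.
rewrite -[formal_diag _](comp_invK (@formal_compA R n) (@formal_comp1l R n)
  X0 (@formal_diag_vanish _ _ _) YX) -A_X.
apply: (taylor_comp (G := F i \o sum_map X)) SY _.
  exact: formal_comp_vanish (A0 i) X0.
exact: taylor_comp X0 (FA i) SX.
Qed.
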